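(* Let $\zeta\in(0,1)$, $c>0$, $x_0\in\mathbb{X}$, let $P^*$ be a diffuse probability measure on $\mathbb{X}$, and set $P_0=\zeta\delta_{x_0}+(1-\zeta)P^*$. Let $\tilde P\sim\mathrm{hNRMI}(\rho;c,P_0)$ (inner spike and slab model), and let $\tilde Q=\zeta\delta_{x_0}+(1-\zeta)Q^*$ with $Q^*\sim\mathrm{hNRMI}(\rho;c,P^* )$ (outer spike and slab model). Let $f:\mathbb{X}\to\mathbb{R}$ be any measurable function such that $P^*(f^2)<\infty$. Then $$\mathrm{var}(\tilde P(f))-\mathrm{var}(\tilde Q(f))=p\,\zeta(1-\zeta)\,P^*\big(\{f-f(x_0)\}^2\big)\ \ge\ 0,$$ where $p=c\int_0^\infty u\,e^{-c\psi(u)}\tau_2(u)\,du\in(0,1)$.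
   Context: $\mathbb{X}$ is a Polish space with its Borel $\sigma$-algebra. A completely random measure (CRM) on $\mathbb{X}$ is a random measure $\tilde\mu$ such that $\tilde\mu(A_1),\dots,\tilde\mu(A_k)$ are mutually independent for all pairwise disjoint measurable $A_1,\dots,A_k$. Let $\rho:(0,\infty)\to[0,\infty)$ be measurable with $\int_0^\infty\min(1,s)\rho(s)\,ds<\infty$ and $\int_0^\infty\rho(s)\,ds=\infty$. For $c>0$ and a probability measure $H$ on $\mathbb{X}$, let $\tilde\mu$ be the (homogeneous, almost surely finite) CRM with Lévy intensity $\rho(s)\,ds\,c\,H(dx)$, i.e. for every measurable $g:\mathbb{X}\to[0,\infty)$, $$\mathbb{E}\Big[e^{-\int g\,d\tilde\mu}\Big]=\exp\Big\{-c\int_{\mathbb{X}}\int_0^\infty(1-e^{-sg(x)})\rho(s)\,ds\,H(dx)\Big\}.$$ $\mathrm{hNRMI}(\rho;c,H)$ denotes the law of the random probability measure $\tilde\mu/\tilde\mu(\mathbb{X})$. For $u>0$ and integer $q\ge1$: $\tau_q(u)=\int_0^\infty s^q e^{-us}\rho(s)\,ds$ and $\psi(u)=\int_0^\infty(1-e^{-us})\rho(s)\,ds$. For a (random) probability measure $P$, $P(f)=\int f\,dP$. *)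

(* Defs.v *)
From HB Require Import structures.
From mathcomp Require Import all_boot all_order all_algebra.
From mathcomp Require Import all_classical all_reals all_analysis.
From mathcomp Require Import measurable_realfun.

Set Implicit Arguments.
Unset Strict Implicit.
Unset Printing Implicit Defensive.

Import Order.TTheory GRing.Theory Num.Theory.
Import numFieldNormedType.Exports.

Local Open Scope classical_set_scope.
Local Open Scope ring_scope.
Local Open Scope ereal_scope.

(* Separable and completely metrizable; the metric is not part of the data. *)
Definition polish (R : realType) (X : topologicalType) : Prop :=
  (exists2 D : set X, countable D & dense D) /\
  exists dist : X -> X -> R,
    [/\ (forall x y, 0 <= dist x y)%R /\ (forall x y, dist x y = 0%R <-> x = y),
        (forall x y, dist x y = dist y x),
        (forall x y z, dist x z <= dist x y + dist y z)%R,
        (forall x, nbhs x = filter_from [set e : R | (0 < e)%R]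
                                        (fun e => [set y | (dist x y < e)%R])) &
        (forall v : nat -> X,
          (forall e : R, (0 < e)%R -> exists N : nat, forall m n : nat,
             (N <= m)%N -> (N <= n)%N -> (dist (v m) (v n) < e)%R) ->
          exists l : X, v @ \oo --> l)].

Notation borel X := (g_sigma_algebraType (@open X)).

Section levy.
Context (R : realType).
Implicit Types (rho : R -> R) (c u : R).

(* A function (0, oo) -> [0, oo) is a function on R of which only the
   restriction to (0, oo) is ever used. *)
Definition levy_density rho : Prop :=
  [/\ measurable_fun (`]0%R, +oo[ : set R) rho,
      (forall s, 0 < s -> 0 <= rho s)%R,
      \int[lebesgue_measure]_(s in `]0%R, +oo[) (Num.min 1 s * rho s)%:E < +oo &
      \int[lebesgue_measure]_(s in `]0%R, +oo[) (rho s)%:E = +oo].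

(* Extended-real valued: no integrability is presupposed. *)
Definition tau rho (q : nat) u : \bar R :=
  \int[lebesgue_measure]_(s in `]0%R, +oo[)
    (s ^+ q * expR (- (u * s)) * rho s)%:E.

Definition psi rho u : \bar R :=
  \int[lebesgue_measure]_(s in `]0%R, +oo[)
    ((1 - expR (- (u * s))) * rho s)%:E.

Definition pcoef rho c : \bar R :=
  c%:E * \int[lebesgue_measure]_(u in `]0%R, +oo[)
           (u%:E * expeR (- (c%:E * psi rho u)) * tau rho 2 u).

End levy.

Section crm.
Context (R : realType).

(* Taking some of the [B i] to be the whole line yields the product rule for
   every subfamily. *)
Definition mutually_independent d (S : measurableType d)
    (Pr : probability S R) (k : nat) (Y : 'I_k -> S -> \bar R) : Prop :=
  forall B : 'I_k -> set (\bar R), (forall i, measurable (B i)) ->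
    Pr (\bigcap_i (Y i @^-1` B i)) = \prod_(i < k) Pr (Y i @^-1` B i).

Context d (T : measurableType d) d' (S : measurableType d').
Variable Pr : probability S R.

(* A random measure on [T], defined on the probability space [S], is a kernel
   from [S] to [T]. *)
Definition completely_random (mu : R.-ker S ~> T) : Prop :=
  forall (k : nat) (A : 'I_k -> set T),
    (forall i, measurable (A i)) -> trivIset setT A ->
    mutually_independent Pr (fun i w => mu w (A i)).

(* Lévy intensity [rho(s) ds c H(dx)], through the Laplace functional. *)
Definition levy_intensity (rho : R -> R) (c : R) (H : probability T R)
    (mu : R.-ker S ~> T) : Prop :=
  forall g : T -> R, measurable_fun setT g -> (forall x, (0 <= g x)%R) ->
    \int[Pr]_w expeR (- \int[mu w]_x (g x)%:E) =
    expeR (- (c%:E * \int[H]_x \int[lebesgue_measure]_(s in `]0%R, +oo[)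
                       ((1 - expR (- (s * g x))) * rho s)%:E)).

Definition homogeneous_crm (rho : R -> R) (c : R) (H : probability T R)
    (mu : R.-ker S ~> T) : Prop :=
  [/\ completely_random mu,
      levy_intensity rho c H mu &
      {ae Pr, forall w, mu w setT < +oo}].

End crm.

(* [hNRMI rho c H L]: [L] is the law of [mu / mu(T)], where [mu] is a CRM with
   Lévy intensity [rho(s) ds c H(dx)] on some probability space. A law on random
   probability measures is a probability on [pprobability T R], the space of
   probabilities with the sigma-algebra generated by evaluations. The second
   argument of [mnormalize] is the value on the null event where [mu(T)] is 0
   or infinite, and is immaterial. *)
Definition hNRMI (R : realType) d (T : measurableType d) (rho : R -> R) (c : R)
    (H : probability T R) (L : probability (pprobability T R) R) : Prop :=
  exists (d' : measure_display) (S : measurableType d') (Pr : probability S R)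
      (mu : R.-ker S ~> T),
    homogeneous_crm Pr rho c H mu /\
    forall A : set (pprobability T R), measurable A ->
      L A = Pr [set w | A (mnormalize (mu w) H : pprobability T R)].

Section spike_slab.
Context (R : realType) d (T : measurableType d).
Variables (z : {i01 R}) (x0 : T) (P : probability T R).

Definition spike_slab : set T -> \bar R :=
  measure_add (mscale (z%:num)%:nng%R (@dirac _ T x0 R))
              (mscale (1 - z%:num)%:nng%R P).

HB.instance Definition _ := Measure.on spike_slab.

Let spike_slab_setT : spike_slab [set: T] = 1.
Proof.
rewrite /spike_slab measure_addE /= /mscale/= diracT probability_setT !mule1.
by rewrite -EFinD addrC subrK.
Qed.

HB.instance Definition _ :=
  Measure_isProbability.Build _ _ _ spike_slab spike_slab_setT.

End spike_slab.

Definition diffuse (R : realType) d (T : measurableType d)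
    (P : probability T R) : Prop := forall x : T, P [set x] = 0.

(* Main.v *)
Require Import Defs.
From HB Require Import structures.
From mathcomp Require Import all_boot all_order all_algebra.
From mathcomp Require Import all_classical all_reals all_analysis.
From mathcomp Require Import measurable_realfun.
From mathcomp Require Import ring lra.

Set Implicit Arguments.
Unset Strict Implicit.
Unset Printing Implicit Defensive.

Import Order.TTheory GRing.Theory Num.Theory.
Import numFieldNormedType.Exports.

Local Open Scope classical_set_scope.
Local Open Scope ring_scope.
Local Open Scope ereal_scope.

(* Let mu be the CRM, T = mu(X), f >= 0 and M = mu(f). Along t = 2^-n, the
   quotients (1 - e^(-tM)) / t increase to M. Squaring them and integrating
   against e^(-uT) gives a second difference of Laplace functionals; the same
   monotone limit on the side of the Lévy exponent yields
     E[e^(-uT) M^2] = e^(-c psi(u)) (c tau_2(u) H(f^2) + c^2 tau_1(u)^2 H(f)^2)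
   without any differentiation under the integral. As T lies in (0, oo) almost
   surely, integrating against u du turns e^(-uT) into 1 / T^2, so that
   P = mu / T satisfies E[P(f)^2] = p H(f^2) + q H(f)^2, where
   q = c^2 \int u e^(-c psi(u)) tau_1(u)^2 du. Taking f = 1 gives p + q = 1, and
   polarization gives E[P(f)] = H(f), hence var(P(f)) = p var_H(f) for every f
   in L^2(H). The theorem is this formula for H = P_0 and for H = P^*. *)

(** Why second moments alone: p + q = 1 says that u times the second derivative of e^(-c psi(u))
    integrates to 1, which analytically would require differentiating psi twice and controlling
    boundary terms at 0 and at infinity. The case f = 1 replaces that computation, and the mean then
    comes from comparing f + 1 with f, so no separate first-moment formula has to be derived. The
    obstacle is that little is known to be finite beforehand: M may be infinite, and f in L^2(H)
    need not be integrable for every realization of P. Moments are therefore computed for f >= 0 in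
    the extended reals, where Tonelli and monotone convergence ask for no integrability; identities
    that would involve a subtraction are written as equalities between sums of nonnegative terms.
    Signed f are treated last, through f^+, f^- and |f|. The infinite mass of rho enters through T >
    0 almost surely and through the positivity of the tau_q. *)

Lemma integral_probability_cst d (T : measurableType d) (R : realType)
    (P : probability T R) (r : \bar R) : \int[P]_x r = r.
Proof. by rewrite integral_cst// -[RHS]mule1 -(@probability_setT _ _ _ P). Qed.

Lemma Rintegral_probability_cst d (T : measurableType d) (R : realType)
    (P : probability T R) (r : R) : (\int[P]_x r = r)%R.
Proof. by rewrite /Rintegral integral_probability_cst. Qed.

Lemma measurable_funXe d (T : measurableType d) (R : realType)
    (f : T -> \bar R) k :
  measurable_fun [set: T] f -> measurable_fun [set: T] (fun t => f t ^+ k).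
Proof.
move=> mf; elim: k => [|k ih].
  by rewrite (_ : (fun _ => _) = cst 1)//; apply/funext => t; rewrite expe0.
rewrite (_ : (fun _ => _) = (f \* (fun t => f t ^+ k))).
  exact: emeasurable_funM.
by apply/funext => t; rewrite expeS.
Qed.

Lemma measurable_expRN d (T : measurableType d) (R : realType) (g : T -> R) :
  measurable_fun [set: T] g ->
  measurable_fun [set: T] (fun x => expR (- g x))%R.
Proof.
by move=> mg; apply: measurableT_comp => //; exact: measurableT_comp.
Qed.

(** * Dyadic difference quotients of the exponential *)

Section exp_quotient.
Context {R : realType}.
Implicit Types (x : \bar R) (r : R) (n : nat).

(* The quotient (1 - e^(-tx)) / t at t = 2^-n; dyadic steps make monotonicity in
   n the inequality 1 - y^2 <= 2 (1 - y) with y = e^(-tx). *)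
Definition exp_quot n x : \bar R :=
  ((2 ^+ n)%:E * (1 - expeR (- (((2 ^+ n)^-1)%:E * x))))%E.

Lemma exp_quotE n r :
  exp_quot n r%:E = ((2 ^+ n) * (1 - expR (- ((2 ^+ n)^-1 * r))))%:E.
Proof. by []. Qed.

Lemma exp_quoty n : exp_quot n +oo = (2 ^+ n)%:E.
Proof.
by rewrite /exp_quot gt0_muley ?lte_fin ?invr_gt0 ?exprn_gt0//= sube0 mule1.
Qed.

Lemma exp_quot_ge0 n x : 0 <= x -> 0 <= exp_quot n x.
Proof.
move: x => [r| |]// r0; last by rewrite exp_quoty lee_fin exprn_ge0.
rewrite exp_quotE lee_fin mulr_ge0 ?exprn_ge0// subr_ge0.
by rewrite -expR0 ler_expR oppr_le0 mulr_ge0// invr_ge0 exprn_ge0.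
Qed.

Lemma exp_quotS n x : 0 <= x -> exp_quot n x <= exp_quot n.+1 x.
Proof.
move: x => [r| |]// r0; last first.
  by rewrite !exp_quoty lee_fin exprS ler_peMl ?exprn_ge0// ler1n.
rewrite !exp_quotE lee_fin.
have -> : ((2 ^+ n)^-1 * r = ((2 ^+ n.+1)^-1 * r) *+ 2)%R.
  by rewrite exprS invfM -mulr_natr; field; rewrite expf_neq0.
rewrite -mulNrn mulr2n expRD exprS; set y := expR _.
rewrite [leRHS](_ : _ = 2 ^+ n * (2 * (1 - y)))%R; last by ring.
rewrite ler_wpM2l ?exprn_ge0//.
have := sqr_ge0 (1 - y)%R; rewrite expr2; nra.
Qed.

Lemma nd_exp_quot x : 0 <= x ->
  {homo exp_quot ^~ x : n m / (n <= m)%N >-> n <= m}.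
Proof. by move=> x0; apply/nondecreasing_seqP => n; exact: exp_quotS. Qed.

Lemma expRN_ge r : (1 - r <= expR (- r))%R.
Proof. exact: expR_ge1Dx. Qed.

(** From e^r >= 1 + r and (1 + r)(1 - r + r^2) = 1 + r^3 >= 1. *)
Lemma expRN_le r : (0 <= r)%R -> (expR (- r) <= 1 - r + r ^+ 2)%R.
Proof.
move=> r0; rewrite expRN.
have r1 : (0 < 1 + r)%R by rewrite ltr_wpDr.
apply: (@le_trans _ _ (1 + r)^-1%R).
  by rewrite lef_pV2 ?posrE ?expR_gt0// expR_ge1Dx.
rewrite -[leLHS]mul1r ler_pdivrMr//.
rewrite [leRHS](_ : _ = 1 + r ^+ 3)%R; last by ring.
by rewrite lerDl exprn_ge0.
Qed.

(** For x >= 0, x - x^2 <= 1 - e^(-x) <= x; the error is thus at most (v x) x, a convergent sequence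
    times one tending to 0. *)
Lemma cvg_exp_remainder (v x : R^nat) (a : R) :
  (forall n, 0 <= v n)%R -> (forall n, 0 <= x n)%R ->
  (fun n => v n * x n)%R @ \oo --> a -> x @ \oo --> (0 : R)%R ->
  (fun n => v n * (1 - expR (- x n)))%R @ \oo --> a.
Proof.
move=> v0 x0 va x_0.
apply: (@squeeze_cvgr _ _ _ _ (fun n => v n * x n - (v n * x n) * x n)%R
   (fun n => v n * x n)%R) => //.
  apply: nearW => n; apply/andP; split.
    rewrite -mulrA -mulrBr ler_wpM2l// lerBrDl addrC.
    by have := expRN_le (x0 n); rewrite expr2; lra.
  by rewrite ler_wpM2l// lerBlDr; have := expRN_ge (x n); lra.
rewrite -[X in _ --> X]subr0 -(mulr0 a).
by apply: cvgB => //; exact: cvgM.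
Qed.

Lemma cvg_exp2V : (fun n => (2 ^+ n)^-1 : R)%R @ \oo --> (0 : R)%R.
Proof.
under eq_fun do rewrite -exprVn.
by apply: cvg_expr; rewrite ger0_norm ?invr_ge0// invf_lt1// ltr1n.
Qed.

Lemma cvg_exp_quot x : 0 <= x -> exp_quot n x @[n --> \oo] --> x.
Proof.
move: x => [r| |]// r0.
  rewrite (_ : exp_quot ^~ _ = EFin \o
    (fun n => (2 ^+ n) * (1 - expR (- ((2 ^+ n)^-1 * r))))%R)//.
  apply: cvg_EFin; first by apply: nearW.
  rewrite /comp/=.
  apply: cvg_exp_remainder.
  - by move=> n; rewrite exprn_ge0.
  - by move=> n; rewrite mulr_ge0// invr_ge0 exprn_ge0.
  - under eq_fun do rewrite mulrA divff ?expf_neq0 ?mul1r//.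
    exact: cvg_cst.
  - rewrite -(mul0r r); apply: cvgM; [exact: cvg_exp2V|exact: cvg_cst].
(* At x = +oo the quotient is 2^n itself, which exceeds n. *)
under eq_fun do rewrite exp_quoty.
apply/cvgeryP; apply/cvgryPge => A; near=> n.
have : (A <= n%:R)%R by near: n; exact: nbhs_infty_ger.
move=> /le_trans; apply.
by rewrite -natrX ler_nat ltnW// ltn_expl.
Unshelve. all: by end_near. Qed.

Lemma measurable_expeR : measurable_fun [set: \bar R] (@expeR R).
Proof.
rewrite (_ : expeR = (fun x => if x == +oo then +oo else
   if x == -oo then 0 else (expR (fine x))%:E)); last first.
  by apply/funext => -[r| |].
apply: measurable_fun_ifT => //; first exact: measurable_fun_eqe.
apply: measurable_fun_ifT => //; first exact: measurable_fun_eqe.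
by apply/measurable_EFinP; apply: measurableT_comp.
Qed.

Lemma measurable_exp_quot n : measurable_fun [set: \bar R] (exp_quot n).
Proof.
apply: measurable_funeM; apply: emeasurable_funB => //.
apply: (measurableT_comp measurable_expeR).
apply: measurableT_comp => //; exact: measurable_funeM.
Qed.

(** Monotone convergence. [F] is extended-real valued because it will also be M = mu(f), whose
    finiteness is not known. *)
Lemma cvg_integral_exp_quot d (T : measurableType d)
    (mu : {measure set T -> \bar R}) (g : T -> R) (F : T -> \bar R) k :
  measurable_fun [set: T] g -> (forall t, 0 <= g t)%R ->
  measurable_fun [set: T] F -> (forall t, 0 <= F t) ->
  \int[mu]_t ((g t)%:E * exp_quot n (F t) ^+ k) @[n --> \oo] -->
  \int[mu]_t ((g t)%:E * F t ^+ k).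
Proof.
move=> mg g0 mF F0.
have cvgX (t : T) j : exp_quot n (F t) ^+ j @[n --> \oo] --> F t ^+ j.
  elim: j => [|j ih]; first by under eq_fun do rewrite expe0; exact: cvg_cst.
  rewrite expeS; under eq_fun do rewrite expeS.
  apply: cvgeM; last exact: ih; last exact: cvg_exp_quot.
  (* [cvgeM] asks that [F t * F t ^+ j] not be a product of 0 and infinity: if [F t] is +oo, its
     power is 1 or +oo. *)
  have : 0 <= F t by [].
  case: (F t) => [r| |]// r0; first by rewrite -EFin_expe mule_def_fin.
  have yX i : (+oo ^+ i.+1 = +oo :> \bar R).
    by elim: i => // i ihi; rewrite expeS ihi mulyy.
  by case: j {ih} => [|j]; rewrite ?expe0 ?yX// /mule_def/= oner_eq0.
have -> : \int[mu]_t ((g t)%:E * F t ^+ k) =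
    \int[mu]_t limn (fun n => (g t)%:E * exp_quot n (F t) ^+ k).
  apply: eq_integral => t _; apply/esym/cvg_lim => //.
  by apply: cvgeZl.
apply: cvg_monotone_convergence => //.
- move=> n; apply: emeasurable_funM; first exact/measurable_EFinP.
  apply: measurable_funXe.
  exact: measurableT_comp (measurable_exp_quot n) mF.
- move=> n t _; rewrite mule_ge0 ?lee_fin// expe_ge0// exp_quot_ge0//.
- move=> t _ n m nm; rewrite lee_wpmul2l ?lee_fin//.
  elim: (k) => [|j ih]; first by rewrite !expe0.
  by rewrite !expeS lee_pmul ?expe_ge0 ?exp_quot_ge0// nd_exp_quot.
Qed.

Lemma exp_quot_le n x : 0 <= x -> exp_quot n x <= x.
Proof.
move: x => [r| |]// r0; last by rewrite leey.
rewrite exp_quotE lee_fin mulrBr mulr1 lerBlDr -lerBlDl.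
have := expRN_ge ((2 ^+ n)^-1 * r)%R; rewrite -(@ler_pM2l _ (2 ^+ n)%R) ?exprn_gt0//.
by rewrite mulrBr mulr1 mulrA divff ?expf_neq0// mul1r.
Qed.

(** Domination by the limit makes every approximant finite, so the convergence can be read in R,
    where Lévy exponents are later subtracted. *)
Lemma cvg_fine_integral_exp_quot d (T : measurableType d)
    (mu : {measure set T -> \bar R}) (g : T -> R) (F : T -> \bar R) k :
  measurable_fun [set: T] g -> (forall t, 0 <= g t)%R ->
  measurable_fun [set: T] F -> (forall t, 0 <= F t) ->
  \int[mu]_t ((g t)%:E * F t ^+ k) < +oo ->
  (forall n, \int[mu]_t ((g t)%:E * exp_quot n (F t) ^+ k) \is a fin_num) /\
  fine (\int[mu]_t ((g t)%:E * exp_quot n (F t) ^+ k)) @[n --> \oo] -->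
  fine (\int[mu]_t ((g t)%:E * F t ^+ k)).
Proof.
move=> mg g0 mF F0 Foo.
have mG (G : T -> \bar R) : measurable_fun [set: T] G ->
    measurable_fun [set: T] (fun t => (g t)%:E * G t ^+ k).
  move=> mG; apply: emeasurable_funM; first exact/measurable_EFinP.
  exact: measurable_funXe.
have mq n : measurable_fun [set: T] (fun t => exp_quot n (F t)).
  exact: measurableT_comp (measurable_exp_quot n) mF.
have G0 n t : 0 <= (g t)%:E * exp_quot n (F t) ^+ k.
  by rewrite mule_ge0 ?lee_fin// expe_ge0// exp_quot_ge0.
have fin n : \int[mu]_t ((g t)%:E * exp_quot n (F t) ^+ k) \is a fin_num.
  rewrite ge0_fin_numE; last exact: integral_ge0.
  apply: le_lt_trans Foo; apply: ge0_le_integral => //.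
  - exact: mG.
  - exact: mG.
  move=> t _; rewrite lee_wpmul2l ?lee_fin//.
  elim: (k) => [|j ih]; first by rewrite !expe0.
  by rewrite !expeS lee_pmul ?expe_ge0 ?exp_quot_ge0// exp_quot_le.
split=> //; apply: fine_cvg; rewrite fineK.
  exact: cvg_integral_exp_quot.
rewrite ge0_fin_numE//; apply: integral_ge0 => t _.
by rewrite mule_ge0 ?lee_fin// expe_ge0.
Qed.

End exp_quotient.

(** * Lévy densities *)

Section levy_weight.
Context {R : realType}.
Variables (rho : R -> R) (hrho : levy_density rho).
Implicit Types (u s t : R) (q n : nat).

Let mrho : measurable_fun (`]0%R, +oo[ : set R) rho. Proof. by case: hrho. Qed.

(** The exponentially tilted Lévy density, extended by 0 because [rho] is unconstrained outside (0,
    oo). Integrals then run over the whole line, and product measures can be used without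
    restriction; u = 0 gives back rho. *)
Definition levy_weight u s : R :=
  if (0 < s)%R then (expR (- (u * s)) * rho s)%R else 0%R.

Lemma levy_weight_ge0 u s : (0 <= levy_weight u s)%R.
Proof.
rewrite /levy_weight; case: ifPn => // s0.
by case: hrho => _ + _ _ => /(_ s s0) ?; rewrite mulr_ge0// expR_ge0.
Qed.

Lemma measurable_levy_weight :
  measurable_fun [set: R * R] (fun z => levy_weight z.1 z.2).
Proof.
rewrite (_ : (fun _ => _) =
  (fun z => expR (- (z.1 * z.2)) * (rho \_ `]0, +oo[) z.2)%R); last first.
  apply/funext => z; rewrite /levy_weight patchE mem_setE in_itv/= andbT.
  by case: ifPn => //; rewrite mulr0.
apply: measurable_funM.
  apply: measurableT_comp => //; apply: measurableT_comp => //.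
  exact: measurable_funM.
have mr : measurable_fun [set: R] (rho \_ `]0%R, +oo[).
  by apply/(measurable_restrictT _ (measurable_itv _)).
exact: measurableT_comp mr measurable_snd.
Qed.

Lemma measurable_levy_weightr u : measurable_fun [set: R] (levy_weight u).
Proof.
exact: measurable_fun_pair2 measurable_levy_weight.
Qed.

Lemma integral_levy_weight (k : R -> R) u :
  \int[lebesgue_measure]_(s in `]0%R, +oo[) (k s * expR (- (u * s)) * rho s)%:E
  = \int[lebesgue_measure]_s (k s * levy_weight u s)%:E.
Proof.
rewrite integral_mkcond; apply: eq_integral => s _.
rewrite /levy_weight patchE mem_setE in_itv/= andbT.
by case: ifPn => _; rewrite ?mulr0// mulrA.
Qed.

(* The absolute value keeps the integrand nonnegative on the whole line, as
   required by the monotone convergence and Tonelli theorems. *)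
Lemma tauE q u : tau rho q u =
  \int[lebesgue_measure]_s (`|s| ^+ q * levy_weight u s)%:E.
Proof.
rewrite -integral_levy_weight; apply: eq_integral => s.
by rewrite inE/= in_itv/= andbT => s0; rewrite gtr0_norm.
Qed.

Lemma psiE u : psi rho u =
  \int[lebesgue_measure]_s ((1 - expR (- (u * s))) * levy_weight 0 s)%:E.
Proof.
rewrite -integral_levy_weight; apply: eq_integral => s _.
by rewrite mul0r oppr0 expR0 mulr1.
Qed.

Lemma tau_ge0 q u : 0 <= tau rho q u.
Proof.
rewrite tauE; apply: integral_ge0 => s _.
by rewrite lee_fin mulr_ge0// ?exprn_ge0// levy_weight_ge0.
Qed.

Lemma psi_integrand_ge0 u s : (0 <= u)%R ->
  (0 <= (1 - expR (- (u * s))) * levy_weight 0 s)%R.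
Proof.
move=> u0; rewrite /levy_weight; case: ifPn => s0; last by rewrite mulr0.
rewrite mul0r oppr0 expR0 mul1r mulr_ge0//; last by case: hrho => _ + _ _; exact.
by rewrite subr_ge0 -expR0 ler_expR oppr_le0 mulr_ge0// ltW.
Qed.

Lemma psi_ge0 u : (0 <= u)%R -> 0 <= psi rho u.
Proof.
move=> u0; rewrite psiE; apply: integral_ge0 => s _.
by rewrite lee_fin psi_integrand_ge0.
Qed.

(** The gateway from the integrability of min(1, s) rho(s) to every finiteness statement about psi
    and tau. *)
Lemma levy_integral_lty (k : R -> R) (C : R) :
  measurable_fun [set: R] k ->
  (forall s, 0 < s -> 0 <= k s <= C * Num.min 1 s)%R ->
  \int[lebesgue_measure]_s (k s * levy_weight 0 s)%:E < +oo.
Proof.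
move=> mk kC; have C0 : (0 <= C)%R.
  (* The bound at s = 1, where the minimum equals 1, forces C >= 0. *)
  have /andP[/le_trans/[apply]] := kC 1%R ltr01.
  by rewrite minxx mulr1.
pose h s := (Num.min 1 s * levy_weight 0 s)%R.
have h_ge0 s : (0 <= h s)%R.
  have [s0|s0] := ltP 0%R s.
    by rewrite mulr_ge0 ?levy_weight_ge0// le_min ler01 ltW.
  by rewrite /h /levy_weight ltNge s0 mulr0.
have mh : measurable_fun [set: R] h.
  apply: measurable_funM; first exact: measurable_minr.
  exact: measurable_levy_weightr.
have hy : \int[lebesgue_measure]_s (h s)%:E < +oo.
  rewrite -integral_levy_weight; case: hrho => _ _ + _.
  apply: le_lt_trans; rewrite le_eqVlt; apply/orP; left; apply/eqP.
  by apply: eq_integral => s _; rewrite mul0r oppr0 expR0 mulr1.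
apply: (@le_lt_trans _ _ (\int[lebesgue_measure]_s (C%:E * (h s)%:E))); last first.
  rewrite ge0_integralZl_EFin//.
  - by rewrite lte_mul_pinfty ?lee_fin.
  - by move=> s _; rewrite lee_fin.
  - exact/measurable_EFinP.
apply: ge0_le_integral => //.
- move=> s _; rewrite lee_fin/levy_weight; case: ifPn => s0; last by rewrite mulr0.
  have /andP[k0 _] := kC s s0.
  by rewrite mulr_ge0// mulr_ge0 ?expR_ge0//; case: hrho => _ + _ _; exact.
- apply/measurable_EFinP; apply: measurable_funM => //.
  exact: measurable_levy_weightr.
- by apply: measurable_funeM; exact/measurable_EFinP.
move=> s _; rewrite -EFinM lee_fin /h mulrA /levy_weight.
case: ifPn => s0; last by rewrite !mulr0.
rewrite ler_wpM2r//; last by have /andP[] := kC s s0.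
by rewrite mulr_ge0 ?expR_ge0//; case: hrho => _ + _ _; exact.
Qed.

Lemma psi_fin u : (0 <= u)%R -> psi rho u \is a fin_num.
Proof.
move=> u0; rewrite ge0_fin_numE ?psi_ge0// psiE.
(* 1 - e^(-us) is at most 1 and at most us, hence at most (1 + u) min(1, s). *)
apply: (@levy_integral_lty _ (1 + u)%R).
  apply: measurable_funB => //; apply: measurableT_comp => //.
  by apply: measurableT_comp => //; exact: measurable_funM.
move=> s s0; apply/andP; split.
  by rewrite subr_ge0 -expR0 ler_expR oppr_le0 mulr_ge0// ltW.
have e0 := expR_gt0 (- (u * s))%R.
have := expRN_ge (u * s)%R.
by rewrite /Num.min; case: ifPn; [move=> _; nra|move=> _; nra].
Qed.

Lemma tau_fin q u : (q == 1%N) || (q == 2%N) -> (0 < u)%R ->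
  tau rho q u \is a fin_num.
Proof.
move=> q12 u0; rewrite ge0_fin_numE ?tau_ge0// tauE.
rewrite [ltLHS](_ : _ = \int[lebesgue_measure]_s
   (`|s| ^+ q * expR (- (u * s)) * levy_weight 0 s)%:E); last first.
  apply: eq_integral => s _; rewrite /levy_weight; case: ifPn => _.
    by rewrite mul0r oppr0 expR0 mul1r mulrA.
  by rewrite !mulr0.
have H1 v s : (0 < v)%R -> (0 < s)%R -> (s * expR (- (v * s)) <= v^-1)%R.
  move=> v0 s0; rewrite expRN ler_pdivrMr ?expR_gt0//.
  rewrite -ler_pdivrMl ?invr_gt0// invrK.
  have := expR_ge1Dx (v * s)%R; lra.
have H2 v s : (0 < v)%R -> (0 < s)%R -> (expR (- (v * s)) <= 1)%R.
  by move=> v0 s0; rewrite -expR0 ler_expR oppr_le0 mulr_ge0// ltW.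
(* One constant for both orders: s e^(-us) is at most s and 1/u, while s^2 e^(-us) is at most s^2
   and (2/u)^2. *)
apply: (@levy_integral_lty _ ((1 + u^-1) ^+ 2 * 4)%R).
  apply: measurable_funM.
    by apply: measurable_funX; exact: normr_measurable.
  apply: measurableT_comp => //.
  by apply: measurableT_comp => //; exact: measurable_funM.
move=> s s0; rewrite gtr0_norm// mulr_ge0 ?exprn_ge0 ?expR_ge0 ?ltW//=.
have ui : (0 < u^-1)%R by rewrite invr_gt0.
have [/eqP ->|] := boolP (q == 1%N).
  rewrite expr1; have := H1 u s u0 s0; have := H2 u s u0 s0.
  have := expR_ge0 (- (u * s))%R.
  by move: (expR _) => e; rewrite /Num.min; case: ifPn => ?; nra.
move=> /negPf q1; move: q12; rewrite q1/= => /eqP ->.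
(* For q = 2 the exponential is split in halves: s^2 e^(-us) = y^2 with y = s e^(-us/2), and the
   bound of order 1 applies to y with u/2. *)
have u20 : (0 < u / 2)%R by rewrite divr_gt0.
have := H1 _ _ u20 s0; have := H2 _ _ u20 s0.
have -> : (u * s = u / 2 * s + u / 2 * s)%R by field.
rewrite opprD expRD; have := expR_ge0 (- (u / 2 * s))%R.
move: (expR _) => e e0 e1; rewrite invfM invrK => e2.
have -> : (s ^+ 2 * (e * e) = (s * e) ^+ 2)%R by ring.
set y := (s * e)%R in e2 *.
have y0 : (0 <= y)%R by rewrite mulr_ge0// ltW.
have ys : (y <= s)%R by rewrite /y ler_piMr// ltW.
by rewrite /Num.min; case: ifPn => s1; rewrite expr2; nra.
Qed.

End levy_weight.

(** Let Phi be the Lévy exponent and t = 2^-n. With [al] = c Phi(t) and [be] = c (2 Phi(t) -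
    Phi(2t)), this is the second difference of e^(-c Phi) at 0, t, 2t, divided by t^2. [al] is of
    order t and contributes a^2; [be] is of order t^2 and contributes b. *)
Lemma cvg_second_difference {R : realType} (al be : R^nat) (a b : R) :
  (forall n, 0 <= al n)%R -> (forall n, 0 <= be n)%R ->
  (fun n => 2 ^+ n * al n)%R @ \oo --> a ->
  (fun n => (2 ^+ n) ^+ 2 * be n)%R @ \oo --> b ->
  (fun n => (2 ^+ n) ^+ 2 *
    (1 + expR (- (2 * al n - be n)) - 2 * expR (- al n)))%R @ \oo --> (a ^+ 2 + b)%R.
Proof.
move=> al0 be0 ha hb.
have vV := @cvg_exp2V R.
have hal : al @ \oo --> (0 : R)%R.
  rewrite (_ : al = fun n => (2 ^+ n)^-1 * (2 ^+ n * al n))%R; last first.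
    by apply/funext => n; rewrite mulrA mulVf ?mul1r// expf_neq0.
  by rewrite -(mul0r a); exact: cvgM.
have hbe : be @ \oo --> (0 : R)%R.
  rewrite (_ : be = fun n =>
      (2 ^+ n)^-1 * (2 ^+ n)^-1 * ((2 ^+ n) ^+ 2 * be n))%R; last first.
    by apply/funext => n; field; rewrite expf_neq0.
  have vV2 : (fun n => (2 ^+ n)^-1 * (2 ^+ n)^-1 : R)%R @ \oo --> (0 * 0 : R)%R.
    exact: cvgM.
  by rewrite mul0r in vV2; rewrite -(mul0r b); exact: cvgM.
(* Adding and subtracting e^(-2 al) separates a squared first-order quotient from the part due to
   [be]. *)
rewrite (_ : (fun _ => _) = (fun n => (2 ^+ n * (1 - expR (- al n))) ^+ 2 +
   ((2 ^+ n) ^+ 2 * (1 - expR (- be n))) * expR (be n - 2 * al n))%R); last first.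
  apply/funext => n.
  have -> : (expR (be n - 2 * al n) = expR (- (2 * al n - be n)))%R by rewrite opprB.
  have h1 : (expR (- be n) * expR (- (2 * al n - be n)) = expR (- al n) ^+ 2)%R.
    by rewrite -expRD -expRM_natl; congr expR; ring.
  rewrite exprMn; set v := (_ ^+ 2)%R; rewrite -mulrA -mulrDr; congr (_ * _)%R.
  rewrite mulrBl h1; ring.
rewrite -{1}(mulr1 b); apply: cvgD.
  rewrite expr2; under eq_fun do rewrite expr2.
  by apply: cvgM; apply: cvg_exp_remainder => // n; rewrite exprn_ge0.
apply: cvgM; first by apply: cvg_exp_remainder => // n; rewrite exprn_ge0// exprn_ge0.
have h0 : (fun n => be n - 2 * al n)%R @ \oo --> (0 - 2 * 0 : R)%R.
  by apply: cvgB => //; apply: cvgM => //; exact: cvg_cst.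
rewrite mulr0 subrr in h0.
have := cvg_comp _ _ h0 (@continuous_expR R 0%R); rewrite expR0; exact.
Qed.

(** * Lévy exponents as integrals over the space of locations and jumps *)

Section levy_product.
Context {R : realType} d {T : measurableType d}.
Variables (rho : R -> R) (hrho : levy_density rho) (H : probability T R).
Variables (f : T -> R) (mf : measurable_fun [set: T] f).
Hypothesis f0 : forall x, (0 <= f x)%R.
Local Open Scope ring_scope.
Implicit Types (u t : R).

Local Notation TR := (T * measurableTypeR R)%type.
Let N : {measure set TR -> \bar R} := (H \x @lebesgue_measure R)%E.
(** A jump s at x adds s f(x) to mu(f). The absolute value changes nothing where [w] is nonzero and
    keeps [F] nonnegative everywhere. *)
Let F (z : TR) : R := f z.1 * `|z.2|.
Let w u (z : TR) : R := levy_weight rho u z.2.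

Let mF : measurable_fun [set: TR] F.
Proof.
apply: measurable_funM; first exact: measurableT_comp.
exact: measurableT_comp (@normr_measurable R setT) measurable_snd.
Qed.

Let mw u : measurable_fun [set: TR] (w u).
Proof. exact: measurableT_comp (measurable_levy_weightr hrho u) _. Qed.

Let F0 z : 0 <= F z. Proof. by rewrite mulr_ge0. Qed.

Let w0 u z : 0 <= w u z. Proof. exact: levy_weight_ge0. Qed.

Lemma integral_levy_prodX u k :
  (\int[N]_z ((w u z)%:E * (F z)%:E ^+ k) =
   tau rho k u * \int[H]_x (f x ^+ k)%:E)%E.
Proof.
rewrite fubini_tonelli1; last 2 first.
- apply: emeasurable_funM; first exact: (measurable_EFinP _ _).2 (mw u).
  exact: measurable_funXe ((measurable_EFinP _ _).2 mF).
- by move=> z; rewrite mule_ge0 ?lee_fin ?w0// expe_ge0// lee_fin.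
rewrite -ge0_integralZl//; last 3 first.
- by apply/measurable_EFinP; exact: measurable_funX.
- by move=> x _; rewrite lee_fin exprn_ge0.
- exact: tau_ge0.
apply: eq_integral => x _; rewrite /fubini_F muleC tauE -ge0_integralZl_EFin//.
- apply: eq_integral => s _; rewrite /w /F/= -EFin_expe -!EFinM; congr EFin.
  by rewrite exprMn; ring.
- by move=> s _; rewrite lee_fin mulr_ge0 ?exprn_ge0// levy_weight_ge0.
- apply/measurable_EFinP; apply: measurable_funM.
    by apply: measurable_funX; exact: normr_measurable.
  exact: measurable_levy_weightr.
- exact: exprn_ge0.
Qed.

(** Up to the factor c, the Laplace exponent at tf of the CRM whose Lévy density is the tilted
    e^(-us) rho(s). *)
Definition levy_exponent u t : \bar R :=
  \int[N]_z ((1 - expR (- (t * F z))) * w u z)%:E.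

(** The defect 2 Phi(t) - Phi(2t) of the exponent Phi, given directly as an integral of a
    nonnegative function. *)
Definition levy_exponent2 u t : \bar R :=
  \int[N]_z ((1 - expR (- (t * F z))) ^+ 2 * w u z)%:E.

Let e1 t z : 0 <= t -> expR (- (t * F z)) <= 1.
Proof. by move=> t0; rewrite -expR0 ler_expR oppr_le0 mulr_ge0. Qed.

Let me t : measurable_fun [set: TR] (fun z => 1 - expR (- (t * F z))).
Proof.
apply: measurable_funB => //; apply: measurableT_comp => //.
by apply: measurableT_comp => //; exact: measurable_funM.
Qed.

Lemma levy_exponent_ge0 u t : 0 <= t -> (0 <= levy_exponent u t)%E.
Proof.
move=> t0; apply: integral_ge0 => z _.
by rewrite lee_fin mulr_ge0// subr_ge0 e1.
Qed.

Lemma levy_exponent2_ge0 u t : (0 <= levy_exponent2 u t)%E.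
Proof. by apply: integral_ge0 => z _; rewrite lee_fin mulr_ge0// sqr_ge0. Qed.

(** Integrates (1 - y^2) + (1 - y)^2 = 2 (1 - y) with y = e^(-tF). The additive form is meaningful
    even when the values are infinite. *)
Lemma levy_exponentM2 u t : 0 <= t ->
  (levy_exponent u (2 * t) + levy_exponent2 u t =
   levy_exponent u t + levy_exponent u t)%E.
Proof.
move=> t0; have t20 : 0 <= 2 * t by rewrite mulr_ge0.
have m1 s : measurable_fun [set: TR]
    (fun z => ((1 - expR (- (s * F z))) * w u z)%:E).
  by apply/measurable_EFinP; exact: measurable_funM.
have m2 : measurable_fun [set: TR]
    (fun z => ((1 - expR (- (t * F z))) ^+ 2 * w u z)%:E).
  apply/measurable_EFinP; apply: measurable_funM => //.
  exact: measurable_funX.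
have p1 s : 0 <= s -> forall z, [set: TR] z ->
    (0 <= ((1 - expR (- (s * F z))) * w u z)%:E)%E.
  by move=> s0 z _; rewrite lee_fin mulr_ge0// subr_ge0 e1.
rewrite /levy_exponent /levy_exponent2.
rewrite -(ge0_integralD _ measurableT (p1 _ t0) (m1 t) (p1 _ t0) (m1 t)).
rewrite -(ge0_integralD _ measurableT (p1 _ t20) (m1 _) _ m2); last first.
  by move=> z _; rewrite lee_fin mulr_ge0// sqr_ge0.
apply: eq_integral => z _; rewrite -!EFinD; congr EFin.
have -> : - (2 * t * F z) = - (t * F z) + - (t * F z) by ring.
by rewrite expRD; ring.
Qed.

Lemma levy_exponentE n u : (levy_exponent u (2 ^+ n)^-1 =
  ((2 ^+ n)^-1)%:E * \int[N]_z ((w u z)%:E * exp_quot n (F z)%:E ^+ 1))%E.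
Proof.
rewrite /levy_exponent /levy_exponent2 -ge0_integralZl_EFin//; last 2 first.
- move=> z _; apply: mule_ge0; first by rewrite lee_fin w0.
  by apply: expe_ge0; apply: exp_quot_ge0; rewrite lee_fin F0.
- apply: emeasurable_funM; first exact: (measurable_EFinP _ _).2 (mw u).
  apply: measurable_funXe; apply: measurableT_comp (measurable_exp_quot n) _.
  exact: (measurable_EFinP _ _).2 mF.
apply: eq_integral => z _.
rewrite exp_quotE -EFin_expe -!EFinM expr1; congr EFin.
by field; rewrite expf_neq0.
Qed.

Lemma levy_exponent2E n u : (levy_exponent2 u (2 ^+ n)^-1 =
  ((2 ^+ n) ^- 2)%:E * \int[N]_z ((w u z)%:E * exp_quot n (F z)%:E ^+ 2))%E.
Proof.
rewrite /levy_exponent /levy_exponent2 -ge0_integralZl_EFin//; last 2 first.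
- move=> z _; apply: mule_ge0; first by rewrite lee_fin w0.
  by apply: expe_ge0; apply: exp_quot_ge0; rewrite lee_fin F0.
- apply: emeasurable_funM; first exact: (measurable_EFinP _ _).2 (mw u).
  apply: measurable_funXe; apply: measurableT_comp (measurable_exp_quot n) _.
  exact: (measurable_EFinP _ _).2 mF.
apply: eq_integral => z _.
rewrite exp_quotE -EFin_expe -!EFinM; congr EFin.
by field; rewrite expf_neq0.
Qed.

Lemma levy_exponent_cvg u : (0 < u)%R -> (\int[H]_x (f x)%:E < +oo)%E ->
  (forall n, levy_exponent u (2 ^+ n)^-1 \is a fin_num) /\
  (fun n => 2 ^+ n * fine (levy_exponent u (2 ^+ n)^-1)) @ \oo -->
    fine (tau rho 1 u) * fine (\int[H]_x (f x)%:E)%E.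
Proof.
move=> u0 fy; have t1 : tau rho 1 u \is a fin_num by exact: tau_fin.
have H1 : (\int[H]_x (f x)%:E)%E \is a fin_num.
  by rewrite ge0_fin_numE// integral_ge0// => x _; rewrite lee_fin.
have [] := @cvg_fine_integral_exp_quot _ _ _ N (w u) (EFin \o F) 1%N (mw u)
  (w0 u) ((measurable_EFinP _ _).2 mF) _ _.
- by move=> z; rewrite lee_fin.
- rewrite integral_levy_prodX; under eq_integral do rewrite expr1.
  by rewrite -(fineK t1) -(fineK H1) -EFinM ltry.
move=> fin; rewrite integral_levy_prodX.
under [X in fine (tau rho 1 u * X)%E]eq_integral do rewrite expr1.
rewrite fineM// => cv; split=> [n|].
  by rewrite levy_exponentE fin_numM.
apply: cvg_trans cv; apply: near_eq_cvg; apply: nearW => n /=.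
by rewrite levy_exponentE fineM ?fin//= mulrA divff ?mul1r// expf_neq0.
Qed.

Lemma levy_exponent2_cvg u : (0 < u)%R -> (\int[H]_x (f x ^+ 2)%:E < +oo)%E ->
  (forall n, levy_exponent2 u (2 ^+ n)^-1 \is a fin_num) /\
  (fun n => (2 ^+ n) ^+ 2 * fine (levy_exponent2 u (2 ^+ n)^-1)) @ \oo -->
    fine (tau rho 2 u) * fine (\int[H]_x (f x ^+ 2)%:E)%E.
Proof.
move=> u0 fy; have t2 : tau rho 2 u \is a fin_num by exact: tau_fin.
have H2 : (\int[H]_x (f x ^+ 2)%:E)%E \is a fin_num.
  by rewrite ge0_fin_numE// integral_ge0// => x _; rewrite lee_fin exprn_ge0.
have [] := @cvg_fine_integral_exp_quot _ _ _ N (w u) (EFin \o F) 2%N (mw u)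
  (w0 u) ((measurable_EFinP _ _).2 mF) _ _.
- by move=> z; rewrite lee_fin.
- rewrite integral_levy_prodX.
  by rewrite -(fineK t2) -(fineK H2) -EFinM ltry.
move=> fin; rewrite integral_levy_prodX fineM// => cv; split=> [n|].
  by rewrite levy_exponent2E fin_numM.
apply: cvg_trans cv; apply: near_eq_cvg; apply: nearW => n /=.
by rewrite levy_exponent2E fineM ?fin//= mulrA divff ?mul1r// !expf_neq0.
Qed.

(** Splits 1 - e^(-s(u + t f)) as (1 - e^(-us)) + e^(-us) (1 - e^(-t s f)): the damping by e^(-uT)
    costs psi(u) and tilts the density. *)
Lemma levy_laplace_exponent u t : 0 <= u -> 0 <= t ->
  (\int[H]_x \int[lebesgue_measure]_(s in `]0%R, +oo[)
    ((1 - expR (- (s * (u + t * f x)))) * rho s)%:E =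
  psi rho u + levy_exponent u t)%E.
Proof.
move=> u0 t0.
pose p1 (z : TR) := ((1 - expR (- (u * z.2))) * levy_weight rho 0 z.2)%:E.
pose p2 (z : TR) := ((1 - expR (- (t * F z))) * w u z)%:E.
have mp1 : measurable_fun [set: TR] p1.
  apply/measurable_EFinP; apply: measurable_funM; last exact: mw.
  apply: measurable_funB => //; apply: measurableT_comp => //.
  by apply: measurableT_comp => //; exact: measurable_funM.
have mp2 : measurable_fun [set: TR] p2.
  by apply/measurable_EFinP; exact: measurable_funM.
have p10 z : (0 <= p1 z)%E by rewrite lee_fin psi_integrand_ge0.
have p20 z : (0 <= p2 z)%E by rewrite lee_fin mulr_ge0// subr_ge0 e1.
have -> : psi rho u = (\int[N]_z p1 z)%E.
  rewrite fubini_tonelli1//.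
  rewrite (_ : fubini_F _ _ = cst (psi rho u)); last first.
    by apply/funext => x; rewrite /fubini_F psiE.
  exact/esym/integral_probability_cst.
have -> : levy_exponent u t = (\int[N]_z p2 z)%E by [].
rewrite -ge0_integralD// (fubini_tonelli1 (p1 \+ p2)%E); last 2 first.
- exact: emeasurable_funD.
- by move=> z; exact: adde_ge0.
apply: eq_integral => x _; rewrite /fubini_F [LHS]integral_mkcond.
apply: eq_integral => s _; rewrite patchE mem_setE in_itv/= andbT.
rewrite /p1 /p2 /w /levy_weight /F /=; case: ifPn => s0; last by rewrite !mulr0 adde0.
rewrite -EFinD (gtr0_norm s0) mul0r oppr0 expR0; congr EFin.
have -> : - (s * (u + t * f x)) = - (u * s) + - (t * (f x * s)) by ring.
rewrite expRD; ring.
Qed.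

End levy_product.

(** * Exponentially damped moments of a completely random measure *)

Section crm_laplace.
Context {R : realType} d {T : measurableType d} d' {S : measurableType d'}.
Variables (Pr : probability S R) (mu : R.-ker S ~> T).
Variables (rho : R -> R) (hrho : levy_density rho) (c : R) (c_gt0 : (0 < c)%R).
Variables (H : probability T R) (hmu : levy_intensity Pr rho c H mu).
Implicit Types (f : T -> R) (u t : R).

Lemma measurable_kernel_integral f : measurable_fun [set: T] f ->
  (forall x, 0 <= f x)%R ->
  measurable_fun [set: S] (fun w => \int[mu w]_x (f x)%:E).
Proof.
move=> mf f0; apply: measurable_fun_integral_kernel.
- by move=> U mU; exact: measurable_kernel.
- by move=> x; rewrite lee_fin.
- exact/measurable_EFinP.
Qed.

(** The Laplace functional at g = u + t f, for which mu(g) = u T + t M. *)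
Lemma crm_laplace f u t : measurable_fun [set: T] f ->
  (forall x, 0 <= f x)%R -> (0 <= u)%R -> (0 <= t)%R ->
  \int[Pr]_w (expeR (- (u%:E * mu w setT)) *
              expeR (- (t%:E * \int[mu w]_x (f x)%:E))) =
  expeR (- (c%:E * (psi rho u + levy_exponent rho H f u t))).
Proof.
move=> mf f0 u0 t0; rewrite -levy_laplace_exponent// -hmu; last 2 first.
- by apply: measurable_funD => //; exact: measurable_funM.
- by move=> x; rewrite addr_ge0// mulr_ge0.
apply: eq_integral => w _; rewrite -expeRD -oppeD; last first.
  apply: ge0_adde_def; rewrite inE mule_ge0 ?lee_fin//.
  by apply: integral_ge0 => x _; rewrite lee_fin.
congr (expeR (- _)); under [RHS]eq_integral do rewrite EFinD EFinM.
rewrite ge0_integralD//; last 2 first.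
- by move=> x _; rewrite mule_ge0 ?lee_fin.
- by apply: measurable_funeM; exact/measurable_EFinP.
rewrite integral_cst// ge0_integralZl_EFin//.
- by move=> x _; rewrite lee_fin.
- exact/measurable_EFinP.
Qed.

(** For u >= 0 the value e^(-uT) is finite even where T = +oo, so [fine] loses nothing. *)
Definition expNT u (w : S) : R := fine (expeR (- (u%:E * mu w setT))).

Lemma expeRN_fin (x : \bar R) : 0 <= x -> expeR (- x) \is a fin_num.
Proof. by case: x. Qed.

Lemma expNTE u w : (0 <= u)%R -> (expNT u w)%:E = expeR (- (u%:E * mu w setT)).
Proof. by move=> u0; rewrite fineK// expeRN_fin// mule_ge0 ?lee_fin. Qed.

Lemma expNT_ge0 u w : (0 <= expNT u w)%R.
Proof. by rewrite fine_ge0// expeR_ge0. Qed.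

Lemma measurable_expNT u : measurable_fun [set: S] (expNT u).
Proof.
apply: (measurableT_comp (fine_measurable measurableT)).
apply: (measurableT_comp measurable_expeR).
apply: measurableT_comp => //; apply: measurable_funeM.
exact: measurable_kernel.
Qed.

Lemma expNT_laplace u : (0 <= u)%R ->
  \int[Pr]_w (expNT u w)%:E = expeR (- (c%:E * psi rho u)).
Proof.
move=> u0.
have := @crm_laplace (cst 0%R) u 0 _ _ u0 (lexx 0%R).
under eq_integral do rewrite mul0e oppe0 expeR0 mule1 -expNTE//.
move=> ->//; rewrite /levy_exponent integral0_eq ?adde0//.
by move=> z _; rewrite mul0r oppr0 expR0 subrr mul0r.
Qed.

(** Both sides are limits of one sequence: by monotone convergence in w it tends to the moment, and
    through the Laplace functional it is the second difference of [cvg_second_difference]. *)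
Lemma crm_moment2 f u : measurable_fun [set: T] f ->
  (forall x, 0 <= f x)%R -> \int[H]_x (f x ^+ 2)%:E < +oo ->
  (0 < u)%R ->
  \int[Pr]_w ((expNT u w)%:E * (\int[mu w]_x (f x)%:E) ^+ 2) =
  (expR (- (c * fine (psi rho u))) *
   ((c * (fine (tau rho 1 u) * fine (\int[H]_x (f x)%:E))) ^+ 2 +
    c * (fine (tau rho 2 u) * fine (\int[H]_x (f x ^+ 2)%:E))))%:E.
Proof.
move=> mf f0 f2y u_gt0; have u0 := ltW u_gt0.
have f1y : \int[H]_x (f x)%:E < +oo.
  (* f <= 1 + f^2, and H has mass 1. *)
  apply: (@le_lt_trans _ _ (\int[H]_x (1 + (f x ^+ 2)%:E))).
    apply: ge0_le_integral => //.
    - by move=> x _; rewrite lee_fin.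
    - exact/measurable_EFinP.
    - apply: emeasurable_funD => //.
      by apply/measurable_EFinP; exact: measurable_funX.
    - move=> x _; rewrite -EFinD lee_fin; have := f0 x.
      by rewrite expr2; nra.
  rewrite ge0_integralD//; last 2 first.
  - by move=> x _; rewrite lee_fin exprn_ge0.
  - by apply/measurable_EFinP; exact: measurable_funX.
  by rewrite integral_probability_cst lte_add_pinfty// ltry.
have [finA cvgA] := levy_exponent_cvg hrho mf f0 u_gt0 f1y.
have [finB cvgB] := levy_exponent2_cvg hrho mf f0 u_gt0 f2y.
set a := (fine _ * fine _)%R in cvgA *; set b := (fine _ * fine _)%R in cvgB *.
pose ps := fine (psi rho u).
have psE : psi rho u = ps%:E by rewrite fineK// psi_fin.
pose al n := fine (levy_exponent rho H f u (2 ^+ n)^-1).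
pose be n := fine (levy_exponent2 rho H f u (2 ^+ n)^-1).
pose M w := \int[mu w]_x (f x)%:E.
have M0 w : 0 <= M w by apply: integral_ge0 => x _; rewrite lee_fin.
have mM : measurable_fun [set: S] M by exact: measurable_kernel_integral.
pose y n w := fine (expeR (- (((2 ^+ n)^-1)%:E * M w))).
have yE n w : (y n w)%:E = expeR (- (((2 ^+ n)^-1)%:E * M w)).
  by rewrite fineK// expeRN_fin// mule_ge0 ?lee_fin// invr_ge0 exprn_ge0.
have qE n w : exp_quot n (M w) = (2 ^+ n * (1 - y n w))%:E.
  by rewrite /exp_quot -yE.
have y0 n w : (0 <= y n w)%R by rewrite fine_ge0// expeR_ge0.
have my n : measurable_fun [set: S] (y n).
  apply: (measurableT_comp (fine_measurable measurableT)).
  apply: (measurableT_comp measurable_expeR).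
  by apply: measurableT_comp => //; exact: measurable_funeM.
have mg := measurable_expNT u.
have v0 n : (0 <= (2 ^+ n)^-1 :> R)%R by rewrite invr_ge0 exprn_ge0.
have al0 n : (0 <= al n)%R by rewrite fine_ge0// levy_exponent_ge0.
have be0 n : (0 <= be n)%R by rewrite fine_ge0// levy_exponent2_ge0.
have L0 : \int[Pr]_w (expNT u w)%:E = (expR (- (c * ps)))%:E.
  by rewrite expNT_laplace// psE.
have L1 n : \int[Pr]_w (expNT u w * y n w)%:E = (expR (- (c * (ps + al n))))%:E.
  under eq_integral do rewrite EFinM expNTE// yE.
  by rewrite crm_laplace// psE -(fineK (finA n)).
(* y^2 = e^(-2tM) calls for the exponent at 2t, which [levy_exponentM2] expresses by [al] and
   [be]. *)
have L2 n : \int[Pr]_w (expNT u w * y n w ^+ 2)%:E =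
    (expR (- (c * (ps + (2 * al n - be n)))))%:E.
  have t0 : (0 <= 2 * (2 ^+ n)^-1 :> R)%R by rewrite mulr_ge0.
  transitivity (\int[Pr]_w (expeR (- (u%:E * mu w setT)) *
     expeR (- ((2 * (2 ^+ n)^-1)%:E * M w)))).
    apply: eq_integral => w _; rewrite EFinM expNTE// expr2 EFinM yE.
    congr (_ * _); rewrite -expeRD -oppeD; last first.
      by apply: ge0_adde_def; rewrite inE mule_ge0 ?lee_fin.
    by rewrite -ge0_muleDl ?lee_fin// -EFinD mulr_natl mulr2n.
  rewrite crm_laplace// psE.
  have := levy_exponentM2 hrho H mf f0 u (v0 n).
  rewrite -(fineK (finA n)) -(fineK (finB n)).
  rewrite -/(al n) -/(be n) => E2.
  have -> : levy_exponent rho H f u (2 * (2 ^+ n)^-1) = (2 * al n - be n)%:E.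
    have -> : (2 * al n - be n = al n + al n - be n)%R by ring.
    by rewrite EFinB EFinD -E2 addeK.
  by [].
have E n : \int[Pr]_w ((expNT u w)%:E * exp_quot n (M w) ^+ 2) =
    (expR (- (c * ps)) * ((2 ^+ n) ^+ 2 * (1 + expR (- (2 * (c * al n) - c * be n))
       - 2 * expR (- (c * al n)))))%:E.
  transitivity (((2 ^+ n) ^+ 2)%:E * \int[Pr]_w (expNT u w * (1 - y n w) ^+ 2)%:E).
    rewrite -ge0_integralZl_EFin//; last 2 first.
    - by move=> w _; rewrite lee_fin mulr_ge0 ?expNT_ge0 ?sqr_ge0.
    - apply/measurable_EFinP; apply: measurable_funM => //.
      by apply: measurable_funX; exact: measurable_funB.
    apply: eq_integral => w _; rewrite qE -EFin_expe -!EFinM.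
    by congr EFin; rewrite exprMn; ring.
  (* (1 - y)^2 + 2y = 1 + y^2: negative terms change sides so that additivity of nonnegative
     integrals suffices. *)
  have : \int[Pr]_w (expNT u w * (1 - y n w) ^+ 2)%:E +
      (\int[Pr]_w (expNT u w * y n w)%:E + \int[Pr]_w (expNT u w * y n w)%:E) =
      \int[Pr]_w (expNT u w)%:E + \int[Pr]_w (expNT u w * y n w ^+ 2)%:E.
    have m1 : measurable_fun [set: S] (fun w => (expNT u w * y n w)%:E).
      by apply/measurable_EFinP; exact: measurable_funM.
    have p1 w : [set: S] w -> 0 <= (expNT u w * y n w)%:E.
      by rewrite lee_fin mulr_ge0 ?expNT_ge0.
    have m2 : measurable_fun [set: S] (fun w => (expNT u w * y n w ^+ 2)%:E).
      apply/measurable_EFinP; apply: measurable_funM => //.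
      exact: measurable_funX.
    have p2 w : [set: S] w -> 0 <= (expNT u w * y n w ^+ 2)%:E.
      by rewrite lee_fin mulr_ge0 ?expNT_ge0 ?sqr_ge0.
    have m3 : measurable_fun [set: S] (fun w => (expNT u w * (1 - y n w) ^+ 2)%:E).
      apply/measurable_EFinP; apply: measurable_funM => //.
      by apply: measurable_funX; exact: measurable_funB.
    have p3 w : [set: S] w -> 0 <= (expNT u w * (1 - y n w) ^+ 2)%:E.
      by rewrite lee_fin mulr_ge0 ?expNT_ge0 ?sqr_ge0.
    have m4 : measurable_fun [set: S] (fun w => (expNT u w)%:E).
      exact/measurable_EFinP.
    have p4 w : [set: S] w -> 0 <= (expNT u w)%:E by rewrite lee_fin expNT_ge0.
    rewrite -(ge0_integralD _ measurableT p1 m1 p1 m1).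
    rewrite -(ge0_integralD _ measurableT p4 m4 p2 m2).
    rewrite -(ge0_integralD _ measurableT p3 m3); last 2 first.
    - by move=> w /[dup] /p1 ? _; exact: adde_ge0.
    - exact: emeasurable_funD.
    by apply: eq_integral => w _; rewrite -!EFinD; congr EFin; ring.
  rewrite L0 L1 L2 => E1.
  have -> : \int[Pr]_w (expNT u w * (1 - y n w) ^+ 2)%:E =
      (expR (- (c * ps)) + expR (- (c * (ps + (2 * al n - be n)))) -
       (expR (- (c * (ps + al n))) + expR (- (c * (ps + al n)))))%:E.
    by rewrite EFinB [in RHS]EFinD -E1 -EFinD addeK.
  rewrite -EFinM; congr EFin.
  have -> : (expR (- (c * (ps + al n))) =
      expR (- (c * ps)) * expR (- (c * al n)))%R.
    by rewrite -expRD; congr expR; ring.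
  have -> : (expR (- (c * (ps + (2 * al n - be n)))) =
      expR (- (c * ps)) * expR (- (2 * (c * al n) - c * be n)))%R.
    by rewrite -expRD; congr expR; ring.
  by ring.
have := @cvg_integral_exp_quot _ _ _ Pr (expNT u) M 2 mg (expNT_ge0 u) mM M0.
have : (fun n => expR (- (c * ps)) * ((2 ^+ n) ^+ 2 *
    (1 + expR (- (2 * (c * al n) - c * be n)) - 2 * expR (- (c * al n)))))%R @ \oo -->
    (expR (- (c * ps)) * ((c * a) ^+ 2 + c * b))%R.
  apply: cvgM; first exact: cvg_cst.
  apply: cvg_second_difference.
  - by move=> n; rewrite mulr_ge0// ltW.
  - by move=> n; rewrite mulr_ge0// ltW.
  - under eq_fun do rewrite mulrCA.
    by apply: cvgM => //; exact: cvg_cst.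
  - under eq_fun do rewrite mulrCA.
    by apply: cvgM => //; exact: cvg_cst.
move=> h1 h2.
have h3 : (\int[Pr]_w ((expNT u w)%:E * exp_quot n (M w) ^+ 2)) @[n --> \oo] -->
    (expR (- (c * ps)) * ((c * a) ^+ 2 + c * b))%:E.
  under eq_fun do rewrite E.
  by apply: cvg_EFin; [exact: nearW|exact: h1].
by rewrite -(cvg_lim _ h2)// -(cvg_lim _ h3).
Qed.

End crm_laplace.

(** * The integral of u e^(-ut) over the half-line *)

Section gamma2.
Context {R : realType}.
Local Open Scope ring_scope.

Lemma expR_sqr_ge (x : R) : 0 <= x -> x ^+ 2 / 2 <= expR x.
Proof.
move=> x0; apply: le_trans (expR_ge1Dxn 1 x0).
by rewrite (_ : 2`!%:R = 2 :> R)// lerDr.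
Qed.

(** The fundamental theorem of calculus, with [F] the antiderivative found by parts. *)
Lemma integral_id_expRN (t : R) : 0 < t ->
  (\int[lebesgue_measure]_(u in `]0%R, +oo[) (u * expR (- (u * t)))%:E =
   (t ^- 2)%:E)%E.
Proof.
move=> t0; have tn : t != 0 by rewrite gt_eqF.
pose F u : R := - (u / t + t ^- 2) * expR (- (u * t)).
pose h u : R := u * expR (- (u * t)).
have dF (u : R) : is_derive u (1 : R) F (h u).
  have dE : is_derive u (1 : R) (fun u : R => expR (- (u * t)))
      (expR (- (u * t)) * - t).
    apply: (@is_derive1_comp _ expR (fun u => - (u * t))).
    rewrite (_ : (fun u => - (u * t)) = (fun u => - t * u)); last first.
      by apply/funext => v; ring.
    apply: is_derive_eq; rewrite /GRing.scale/=; ring.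
  have dP : is_derive u (1 : R) (fun u : R => - (u / t + t ^- 2)) (- t^-1).
    rewrite (_ : (fun u => - (u / t + t ^- 2)) =
        (fun u => - t^-1 * u - t ^- 2)); last first.
      by apply/funext => v; ring.
    apply: is_derive_eq; rewrite /GRing.scale/=; ring.
  have -> : F = (fun u => - (u / t + t ^- 2)) * (fun u => expR (- (u * t))) by [].
  apply: is_derive_eq; rewrite /GRing.scale/= /h; field.
  by [].
have ch : continuous h.
  move=> u; apply: cvgM; first exact: cvg_id.
  apply: continuous_comp; last exact: continuous_expR.
  by apply: cvgN; apply: cvgM => //; exact: cvg_cst.
have lim : F u @[u --> +oo] --> (0 : R).
  (* Since e^(-ut) <= 2 / (ut)^2, |F u| is at most 2 / (t^3 u) + 2 / (t^4 u^2), hence at most K / u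
     once u >= 1. *)
  pose K := 2 / t ^+ 3 + 2 / t ^+ 4.
  apply/cvgrPdist_le => e e0; near=> u; rewrite sub0r normrN.
  have u1 : 1 <= u by near: u; apply: nbhs_pinfty_ge; exact: num_real.
  have uK : K / e <= u by near: u; apply: nbhs_pinfty_ge; exact: num_real.
  have u0 : 0 < u by rewrite (lt_le_trans ltr01).
  have ut0 : 0 < u * t by rewrite mulr_gt0.
  have P0 : 0 <= u / t + t ^- 2.
    by rewrite addr_ge0 ?invr_ge0 ?exprn_ge0 ?(ltW t0)// divr_ge0// ltW.
  rewrite /F mulNr normrN ger0_norm; last by rewrite mulr_ge0 ?expR_ge0.
  have : expR (- (u * t)) <= ((u * t) ^+ 2 / 2)^-1.
    have ut2 : 0 < (u * t) ^+ 2 / 2 by rewrite divr_gt0// exprn_gt0.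
    by rewrite expRN lef_pV2 ?posrE ?expR_gt0// expR_sqr_ge// ltW.
  move=> /(ler_wpM2l P0) /le_trans; apply.
  rewrite (_ : (u / t + t ^- 2) * _ =
      2 / t ^+ 3 * u^-1 + 2 / t ^+ 4 * (u^-1 * u^-1)); last first.
    by field; rewrite tn gt_eqF.
  apply: (@le_trans _ _ (K * u^-1)).
    rewrite /K [leRHS]mulrDl lerD2l ler_wpM2l ?mulr_ge0 ?invr_ge0 ?exprn_ge0 ?(ltW t0)//.
    by rewrite ler_piMl ?invr_ge0 ?(ltW u0)// invf_le1.
  by rewrite ler_pdivrMr// mulrC -ler_pdivrMr.
rewrite integral_itv_obnd_cbnd; last first.
  apply/measurable_EFinP; apply: measurable_funTS.
  exact: continuous_measurable_fun.
rewrite (@ge0_continuous_FTC2y _ h F 0 0) //.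
- rewrite sub0e /F mul0r add0r mul0r oppr0 expR0 mulr1 -EFinN opprK//.
- by move=> x x0; rewrite mulr_ge0// expR_ge0.
- exact: continuous_subspaceT.
- apply: cvg_at_right_filter.
  have /derivable1_diffP/differentiable_continuous : derivable F 0 1 by [].
  by [].
- by move=> x _; rewrite derive1E; exact: derive_val.
Unshelve. all: by end_near. Qed.

End gamma2.

(** * The coefficients p and q *)

Section levy_measurability.
Context {R : realType}.
Variables (rho : R -> R) (hrho : levy_density rho).
Implicit Types (u : R) (q : nat).
Local Notation D := (`]0%R, +oo[ : set R)%classic.

Lemma measurable_tau q : measurable_fun [set: R] (tau rho q).
Proof.
rewrite (_ : tau rho q = fubini_F (@lebesgue_measure R)
  (fun z : R * measurableTypeR R =>
    (`|z.2| ^+ q * levy_weight rho z.1 z.2)%:E)); last first.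
  by apply/funext => u; rewrite tauE.
apply: measurable_fun_fubini_tonelli_F.
  apply/measurable_EFinP; apply: measurable_funM.
    apply: measurable_funX.
    exact: measurableT_comp (@normr_measurable R setT) measurable_snd.
  exact: measurable_levy_weight.
by move=> z; rewrite lee_fin mulr_ge0// ?exprn_ge0// levy_weight_ge0.
Qed.

Lemma measurable_psi : measurable_fun D (psi rho).
Proof.
(* The absolute value on u makes the integrand nonnegative on the whole plane, as Tonelli
   measurability demands. *)
apply: (eq_measurable_fun (fubini_F (@lebesgue_measure R)
  (fun z : R * measurableTypeR R =>
    ((1 - expR (- (`|z.1| * z.2))) * levy_weight rho 0 z.2)%:E))).
  move=> u; rewrite inE/= in_itv/= andbT => u0.
  by rewrite psiE /fubini_F/= gtr0_norm.
apply: measurable_funTS; apply: measurable_fun_fubini_tonelli_F.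
  apply/measurable_EFinP; apply: measurable_funM.
    apply: measurable_funB => //; apply: measurableT_comp => //.
    apply: measurableT_comp => //; apply: measurable_funM => //.
    exact: measurableT_comp (@normr_measurable R setT) measurable_fst.
  exact: measurableT_comp (measurable_levy_weightr hrho 0) measurable_snd.
by move=> z; rewrite lee_fin psi_integrand_ge0.
Qed.

(** A zero integral would force f = 0 almost everywhere on a half-line of infinite measure. *)
Lemma integral_gt0_itv (f : R -> \bar R) : measurable_fun D f ->
  (forall u, (0 < u)%R -> 0 < f u) ->
  0 < \int[lebesgue_measure]_(u in D) f u.
Proof.
move=> mf f0.
have ge0 u : D u -> 0 <= f u by rewrite /= in_itv/= andbT => /f0/ltW.
rewrite lt_neqAle integral_ge0// andbT; apply/eqP => /esym I0.
have I1 : \int[lebesgue_measure]_(u in D) `|f u| = 0.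
  by rewrite -[RHS]I0; apply: eq_integral => u; rewrite inE => /ge0/gee0_abs.
have [N [mN N0 sN]] : ae_eq (@lebesgue_measure R) D f (cst 0).
  by apply/ae_eq_integral_abs.
have : (lebesgue_measure (D : set (measurableTypeR R)) <= lebesgue_measure N).
  apply: le_measure; rewrite ?inE//.
  move=> u Du; apply: sN => /= /(_ Du) fu.
  by move: Du; rewrite /= in_itv/= andbT => /f0; rewrite fu ltxx.
by rewrite N0 lebesgue_measure_itv/= ltry.
Qed.

(** If it were 0, rho would vanish almost everywhere on (0, oo), against its infinite mass. *)
Lemma tau_gt0 q u : 0 < tau rho q u.
Proof.
rewrite lt_neqAle tau_ge0// andbT; apply/eqP => /esym t0.
have mk : measurable_fun D (fun s => (s ^+ q * expR (- (u * s)) * rho s)%:E).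
  apply/measurable_EFinP; apply: measurable_funM; last by case: hrho.
  apply: measurable_funTS; apply: measurable_funM; first exact: measurable_funX.
  by apply: measurable_expRN; exact: measurable_funM.
have ge0 s : D s -> 0 <= (s ^+ q * expR (- (u * s)) * rho s)%:E.
  rewrite /= in_itv/= andbT => s0; rewrite lee_fin mulr_ge0//.
    by rewrite mulr_ge0 ?expR_ge0// exprn_ge0// ltW.
  by case: hrho => _ + _ _; exact.
have I1 :
    \int[lebesgue_measure]_(s in D) `|(s ^+ q * expR (- (u * s)) * rho s)%:E| = 0.
  by rewrite -[RHS]t0; apply: eq_integral => s; rewrite inE => /ge0/gee0_abs.
have ae0 : ae_eq (@lebesgue_measure R) D
    (fun s => (s ^+ q * expR (- (u * s)) * rho s)%:E) (cst 0).
  by apply/ae_eq_integral_abs.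
have : \int[lebesgue_measure]_(s in D) (rho s)%:E = 0.
  rewrite -(integral0 lebesgue_measure D); apply: ge0_ae_eq_integral => //.
  - by apply/measurable_EFinP; case: hrho.
  - by move=> s /=; rewrite in_itv/= andbT lee_fin => s0; case: hrho => _ + _ _; exact.
  apply: filterS ae0 => s h Ds; move: (h Ds); move: Ds.
  rewrite /= in_itv/= andbT => s0 [] /eqP.
  rewrite mulf_eq0 mulf_eq0 expf_eq0 (gt_eqF s0) andbF/= (gt_eqF (expR_gt0 _))/=.
  by move=> /eqP ->.
by case: hrho => _ _ _ ->.
Qed.

Definition qcoef (c : R) : \bar R :=
  (c ^+ 2)%:E * \int[lebesgue_measure]_(u in D)
    (u%:E * expeR (- (c%:E * psi rho u)) * tau rho 1 u ^+ 2).

(** The pairs (q, k) = (2, 1) and (1, 2) give the integrands of [pcoef] and [qcoef]. *)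
Lemma coef_integrand_gt0 q k (c u : R) : (0 < u)%R ->
  0 < u%:E * expeR (- (c%:E * psi rho u)) * tau rho q u ^+ k.
Proof.
move=> u0; rewrite mule_gt0//; last by rewrite expe_gt0// tau_gt0.
rewrite mule_gt0// -(fineK (psi_fin hrho (ltW u0))) -EFinM -EFinN.
by rewrite lte_fin expR_gt0.
Qed.

Lemma measurable_coef_integrand q k (c : R) : measurable_fun D
  (fun u => u%:E * expeR (- (c%:E * psi rho u)) * tau rho q u ^+ k).
Proof.
apply: emeasurable_funM.
  apply: emeasurable_funM; first exact/measurable_EFinP.
  apply: (measurableT_comp measurable_expeR).
  apply: measurableT_comp => //; apply: measurable_funeM; exact: measurable_psi.
by apply: measurable_funTS; apply: measurable_funXe; exact: measurable_tau.
Qed.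

Lemma pcoef_gt0 c : (0 < c)%R -> 0 < pcoef rho c.
Proof.
move=> c0; rewrite mule_gt0// integral_gt0_itv//.
- exact: (measurable_coef_integrand 2 1).
- by move=> u u0; exact: (coef_integrand_gt0 2 1).
Qed.

Lemma qcoef_gt0 c : (0 < c)%R -> 0 < qcoef c.
Proof.
move=> c0; rewrite mule_gt0 ?lte_fin ?exprn_gt0// integral_gt0_itv//.
- exact: (measurable_coef_integrand 1 2).
- by move=> u u0; exact: (coef_integrand_gt0 1 2).
Qed.

End levy_measurability.

(** * Positivity of the total mass and moments of the normalized measure *)

Section crm_total_mass.
Context {R : realType} d {T : measurableType d} d' {S : measurableType d'}.
Variables (Pr : probability S R) (mu : R.-ker S ~> T).
Variables (rho : R -> R) (hrho : levy_density rho) (c : R) (c_gt0 : (0 < c)%R).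
Variables (H : probability T R) (hmu : levy_intensity Pr rho c H mu).

(** 1 - e^(-ns) increases to 1 for s > 0, and rho has infinite mass. *)
Lemma psi_cvgy : psi rho n%:R @[n --> \oo] --> +oo.
Proof.
have -> : +oo = \int[lebesgue_measure]_s
    limn (fun n => ((1 - expR (- (n%:R * s))) * levy_weight rho 0 s)%:E).
  case: (hrho) => _ _ _ <-; rewrite integral_mkcond; apply: eq_integral => s _.
  apply/esym/cvg_lim => //; rewrite /levy_weight patchE mem_setE in_itv/= andbT.
  case: ifPn => s0; last by under eq_fun do rewrite mulr0; exact: cvg_cst.
  rewrite mul0r oppr0 expR0 mul1r; apply: cvg_EFin; first exact: nearW.
  rewrite /comp/= -[X in _ --> X]mul1r; apply: cvgM; last exact: cvg_cst.
  rewrite -[X in _ --> X]subr0; apply: cvgB; first exact: cvg_cst.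
  have := @cvg_expr R (expR (- s)); rewrite ger0_norm ?expR_ge0//.
  rewrite -expR0 ltr_expR oppr_lt0 expR0 => /(_ s0).
  by move=> h; under eq_fun do rewrite -mulrN expRM_natl.
under eq_fun do rewrite psiE.
apply: cvg_monotone_convergence => //.
- move=> n; apply/measurable_EFinP; apply: measurable_funM.
    apply: measurable_funB => //; apply: measurableT_comp => //.
    by apply: measurableT_comp => //; exact: measurable_funM.
  exact: measurable_levy_weightr.
- by move=> n s _; rewrite lee_fin psi_integrand_ge0.
- move=> s _ n m nm; rewrite lee_fin /levy_weight.
  case: ifPn => s0; last by rewrite !mulr0.
  rewrite ler_wpM2r//.
    rewrite mulr_ge0 ?expR_ge0//; case: hrho => _ + _ _; exact.
  by rewrite lerD2l lerN2 ler_expR lerN2 ler_wpM2r ?ler_nat// ltW.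
Qed.

(** The event T = 0 has probability at most E[e^(-nT)] = e^(-c psi(n)), which tends to 0. *)
Lemma crm_total_gt0 : {ae Pr, forall w, 0 < mu w setT}.
Proof.
pose A := [set w | mu w setT == 0].
have mA : measurable A by exact: kernel_measurable_eq_cst.
exists A; split=> //; last first.
  move=> w /= h; apply/eqP; apply: contrapT => /eqP h0; apply: h.
  by rewrite lt_neqAle eq_sym h0/=.
apply/eqP; rewrite eq_le measure_ge0 andbT.
have le n : Pr A <= expeR (- (c%:E * psi rho n%:R)).
  have -> : Pr A = \int[Pr]_w (\1_A w)%:E by rewrite integral_indic// setIT.
  rewrite -(expNT_laplace hrho hmu)//.
  apply: ge0_le_integral => //.
  - by apply/measurable_EFinP; exact: measurable_indic.
  - by apply/measurable_EFinP; exact: measurable_expNT.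
  move=> w _; rewrite indicE; case: (boolP (w \in A)) => [|_]; last first.
    by rewrite lee_fin expNT_ge0.
  by rewrite inE /A/= expNTE// => /eqP ->; rewrite mule0 oppe0 expeR0.
apply/lee_addgt0Pr => e e0; rewrite add0e.
(* The threshold at which e^(-c psi(n)) falls to e or below. *)
have /cvgeyPge/(_ (- ln e / c)%R)[n _ /(_ n (leqnn n))/= h] := psi_cvgy.
apply: (le_trans (le n)).
rewrite -(fineK (psi_fin hrho (ler0n R n))) in h *; rewrite lee_fin in h.
rewrite -EFinM -EFinN lee_fin -[leRHS]lnK ?posrE// ler_expR lerNl.
by rewrite mulrC -ler_pdivrMr.
Qed.

End crm_total_mass.

Lemma integral_mnormalize (R : realType) d (T : measurableType d)
    (mu : {measure set T -> \bar R}) (P : probability T R) (f : T -> R) :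
  measurable_fun [set: T] f -> (forall x, 0 <= f x)%R ->
  0 < mu setT -> mu setT < +oo ->
  \int[mnormalize mu P]_x (f x)%:E =
  ((fine (mu setT))^-1)%:E * \int[mu]_x (f x)%:E.
Proof.
move=> mf f0 mu0 muy; have t0 : (0 <= (fine (mu setT))^-1)%R.
  by rewrite invr_ge0 fine_ge0// ltW.
pose k := NngNum t0; transitivity (\int[mscale k mu]_x (f x)%:E).
  apply: eq_measure_integral => A mA _.
  by rewrite /= /mnormalize (gt_eqF mu0) (lt_eqF muy)/= /mscale/= muleC.
rewrite ge0_integral_mscale//; first exact/measurable_EFinP.
by move=> x _; rewrite lee_fin.
Qed.

Section crm_normalized.
Context {R : realType} d {T : measurableType d} d' {S : measurableType d'}.
Variables (Pr : probability S R) (mu : R.-ker S ~> T).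
Variables (rho : R -> R) (hrho : levy_density rho) (c : R) (c_gt0 : (0 < c)%R).
Variables (H : probability T R) (hmu : levy_intensity Pr rho c H mu).
Hypothesis mu_fin : {ae Pr, forall w, mu w setT < +oo}.
Local Notation D := (`]0%R, +oo[ : set R)%classic.

Lemma measurable_expNT2 : measurable_fun [set: measurableTypeR R * S]
  (fun z => expNT mu z.1 z.2).
Proof.
apply: (measurableT_comp (fine_measurable measurableT)).
apply: (measurableT_comp measurable_expeR).
apply: measurableT_comp => //; apply: emeasurable_funM.
  by apply/measurable_EFinP; exact: measurable_fst.
exact: measurableT_comp (measurable_kernel mu _ measurableT) measurable_snd.
Qed.

Lemma crm_normalized_moment2 (f : T -> R) : measurable_fun [set: T] f ->
  (forall x, 0 <= f x)%R -> \int[H]_x (f x ^+ 2)%:E < +oo ->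
  \int[Pr]_w (\int[mnormalize (mu w) H]_x (f x)%:E) ^+ 2 =
  pcoef rho c * \int[H]_x (f x ^+ 2)%:E +
  qcoef rho c * (fine (\int[H]_x (f x)%:E) ^+ 2)%:E.
Proof.
move=> mf f0 f2y.
pose M w := \int[mu w]_x (f x)%:E.
have M0 w : 0 <= M w by apply: integral_ge0 => x _; rewrite lee_fin.
have mM : measurable_fun [set: S] M by exact: measurable_kernel_integral.
(* Cutting u off at 0 makes [Phi] nonnegative on the full product and zero for u <= 0. *)
pose Phi (z : measurableTypeR R * S) :=
  ((Num.max z.1 0 * expNT mu z.1 z.2)%R)%:E * M z.2 ^+ 2.
have Phi0 z : 0 <= Phi z.
  rewrite mule_ge0 ?expe_ge0// lee_fin mulr_ge0 ?expNT_ge0//.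
  by rewrite le_max lexx orbT.
have mPhi : measurable_fun setT Phi.
  apply: emeasurable_funM.
    apply/measurable_EFinP; apply: measurable_funM; last exact: measurable_expNT2.
    by apply: measurable_maxr => //; exact: measurable_fst.
  exact: measurableT_comp (measurable_funXe 2 mM) measurable_snd.
transitivity (\int[Pr]_w \int[lebesgue_measure]_u Phi (u, w)).
  apply: ge0_ae_eq_integral => //.
  - apply: measurable_funXe.
    apply: (@measurable_fun_integral_kernel _ _ _ _ _ (knormalize mu H)).
    + by move=> U mU; exact: measurable_kernel.
    + by move=> x; rewrite lee_fin.
    + exact/measurable_EFinP.
  - exact: (measurable_fun_fubini_tonelli_G Phi mPhi Phi0).
  - by move=> w _; rewrite expe_ge0// integral_ge0// => x _; rewrite lee_fin.
  - by move=> w _; exact: integral_ge0.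
  (* On 0 < T < +oo, [mnormalize] is the genuine quotient and the integral over u equals T^-2. *)
  apply: filterS2 mu_fin (crm_total_gt0 hrho c_gt0 hmu) => w Ty T0 _.
  rewrite integral_mnormalize//.
  have tE : mu w setT = (fine (mu w setT))%:E.
    by rewrite fineK// ge0_fin_numE// ltW.
  set t := fine _ in tE *.
  have t0 : (0 < t)%R by rewrite -lte_fin -tE.
  rewrite /Phi/= ge0_integralZr//; last 3 first.
  - apply/measurable_EFinP; apply: measurable_funM.
      by apply: measurable_maxr.
    exact: measurable_fun_pair1 measurable_expNT2.
  - move=> u _; rewrite lee_fin mulr_ge0 ?expNT_ge0//.
    by rewrite le_max lexx orbT.
  - exact: mule_ge0.
  rewrite [X in _ = X * _](_ : _ = (t ^- 2)%:E).
    by rewrite muleACA -EFinM -expr2 exprVn.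
  rewrite -integral_id_expRN// [RHS]integral_mkcond; apply: eq_integral => u _.
  rewrite patchE mem_setE in_itv/= andbT; case: ifPn => u0.
    by rewrite max_l ?ltW// /expNT tE.
  by rewrite max_r ?mul0r// leNgt.
(* After the exchange, the inner integral at fixed u > 0 is u times the damped moment of
   [crm_moment2]. *)
rewrite -(fubini_tonelli Phi)//.
pose G q k u := u%:E * expeR (- (c%:E * psi rho u)) * tau rho q u ^+ k.
set h1 := fine _; pose h2 := fine (\int[H]_x (f x ^+ 2)%:E).
have h2E : \int[H]_x (f x ^+ 2)%:E = h2%:E.
  by rewrite fineK// ge0_fin_numE// integral_ge0// => x _; rewrite lee_fin exprn_ge0.
have h20 : (0 <= h2)%R.
  by rewrite fine_ge0// integral_ge0// => x _; rewrite lee_fin exprn_ge0.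
transitivity (\int[lebesgue_measure]_(u in D)
    ((c * h2)%:E * G 2%N 1%N u + (c ^+ 2 * h1 ^+ 2)%:E * G 1%N 2%N u)).
  rewrite [RHS]integral_mkcond; apply: eq_integral => u _.
  rewrite patchE mem_setE in_itv/= andbT; case: ifPn => u0; last first.
    rewrite integral0_eq// => w _; rewrite /Phi/= max_r ?mul0r ?mul0e//.
    by rewrite leNgt.
  have PhiE w : Phi (u, w) = u%:E * ((expNT mu u w)%:E * M w ^+ 2).
    rewrite muleA -EFinM; congr ((_ * _)%:E * _) => /=.
    by rewrite max_l// ltW.
  under eq_integral do rewrite PhiE.
  rewrite ge0_integralZl_EFin//; last 3 first.
  - by move=> w _; rewrite mule_ge0 ?lee_fin ?expNT_ge0// expe_ge0.
  - apply: emeasurable_funM; last exact: measurable_funXe.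
    by apply/measurable_EFinP; exact: measurable_expNT.
  - exact: ltW.
  rewrite (crm_moment2 hrho c_gt0 hmu mf f0 f2y u0) -/h1 -/h2 /G.
  have t1 : tau rho 1 u = (fine (tau rho 1 u))%:E by rewrite fineK// tau_fin.
  have t2 : tau rho 2 u = (fine (tau rho 2 u))%:E by rewrite fineK// tau_fin.
  have pE : psi rho u = (fine (psi rho u))%:E by rewrite fineK// psi_fin// ltW.
  rewrite pE t1 t2 -!EFin_expe /= -!EFinM -!EFinD; congr EFin; ring.
have mG q k : measurable_fun D (G q k) by exact: measurable_coef_integrand.
have G0 q k u : D u -> 0 <= G q k u.
  by rewrite /= in_itv/= andbT => u0; rewrite ltW// coef_integrand_gt0.
rewrite ge0_integralD//; last 4 first.
- move=> u Du; rewrite mule_ge0//; last exact: G0.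
  by rewrite lee_fin mulr_ge0// ltW.
- by apply: measurable_funeM; exact: mG.
- move=> u Du; rewrite mule_ge0//; last exact: G0.
  by rewrite lee_fin mulr_ge0// sqr_ge0.
- by apply: measurable_funeM; exact: mG.
have c2 : (0 <= c * h2)%R by rewrite mulr_ge0// ltW.
have c3 : (0 <= c ^+ 2 * h1 ^+ 2)%R by rewrite mulr_ge0// sqr_ge0.
rewrite (ge0_integralZl_EFin _ _ _ _ c2)//; [|exact: G0|exact: mG].
rewrite (ge0_integralZl_EFin _ _ _ _ c3)//; [|exact: G0|exact: mG].
rewrite h2E /pcoef /qcoef; congr (_ + _).
  by rewrite EFinM -muleA [RHS]muleAC muleA.
by rewrite EFinM -muleA [RHS]muleAC muleA.
Qed.

End crm_normalized.

(** * Square-integrable functions, positive and negative parts *)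

Lemma sqr_integrable d (T : measurableType d) (R : realType)
    (P : probability T R) (f : T -> R) : measurable_fun [set: T] f ->
  \int[P]_x (f x ^+ 2)%:E < +oo ->
  P.-integrable [set: T] (fun x => (f x ^+ 2)%:E).
Proof.
move=> mf f2; apply/integrableP; split.
  by apply/measurable_EFinP; exact: measurable_funX.
under eq_integral do rewrite gee0_abs ?lee_fin ?sqr_ge0//.
by [].
Qed.

Lemma sqr_integrable1 d (T : measurableType d) (R : realType)
    (P : probability T R) (f : T -> R) : measurable_fun [set: T] f ->
  \int[P]_x (f x ^+ 2)%:E < +oo -> P.-integrable [set: T] (EFin \o f).
Proof.
move=> mf f2; apply: (@le_integrable _ _ _ _ _ _ _ (fun x => (1 + f x ^+ 2)%:E)) => //.
- exact/measurable_EFinP.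
- move=> x _; rewrite /= lee_fin [leRHS]ger0_norm; last first.
    by rewrite addr_ge0// sqr_ge0.
  rewrite -(real_normK (num_real (f x))).
  by have := sqr_ge0 (`|f x| - 1)%R; rewrite !expr2; nra.
rewrite (_ : (fun _ => _) = (fun=> 1%:E) \+ (fun x => (f x ^+ 2)%:E))//.
apply: integrableD => //; last exact: sqr_integrable.
exact: finite_measure_integrable_cst.
Qed.

Lemma sqr_funrposneg (T : Type) (R : realType) (f : T -> R) x :
  (f x ^+ 2 = (f^\+)%R x ^+ 2 + (f^\-)%R x ^+ 2)%R.
Proof.
rewrite /funrpos /funrneg; case: (leP 0%R (f x)) => f0.
  by rewrite max_r ?expr0n ?addr0// oppr_le0.
by rewrite max_l ?expr0n ?add0r ?sqrrN// oppr_ge0 ltW.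
Qed.

Lemma Rintegral_funrposneg d (T : measurableType d) (R : realType)
    (mu : {measure set T -> \bar R}) (f : T -> R) :
  measurable_fun [set: T] f -> mu.-integrable [set: T] (EFin \o f) ->
  [/\ mu.-integrable [set: T] (EFin \o (f^\+)%R),
      mu.-integrable [set: T] (EFin \o (f^\-)%R) &
      (\int[mu]_x f x = \int[mu]_x (f^\+)%R x - \int[mu]_x (f^\-)%R x)%R].
Proof.
move=> mf fi; have ip := integrable_funrpos measurableT fi.
have iN := integrable_funrneg measurableT fi.
split=> //; rewrite -RintegralB//; apply: eq_Rintegral => x _.
by rewrite -[in LHS](funrposBneg f).
Qed.

(** * Random probabilities with the second moments of an hNRMI *)

Section random_probability.
Context {R : realType} d {T : measurableType d} d' {S : measurableType d'}.
Variables (Pr : probability S R) (k : S -> probability T R) (H : probability T R).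
Hypothesis mk : forall U, measurable U -> measurable_fun [set: S] (k ^~ U).
Variables (p q : R).
Hypothesis pq1 : (p + q = 1)%R.
Implicit Types f g : T -> R.

Let mean g : R := (\int[H]_x g x)%R.

(** All that is retained of the law: with p + q = 1, second moments of nonnegative functions
    determine means and variances. *)
Hypothesis moment2 : forall g, measurable_fun [set: T] g ->
  (forall x, 0 <= g x)%R -> \int[H]_x (g x ^+ 2)%:E < +oo ->
  \int[Pr]_w (\int[k w]_x (g x)%:E) ^+ 2 =
  (p * mean (fun x => g x ^+ 2) + q * mean g ^+ 2)%:E.

Lemma measurable_random_integral g : measurable_fun [set: T] g ->
  (forall x, 0 <= g x)%R ->
  measurable_fun [set: S] (fun w => \int[k w]_x (g x)%:E).
Proof.
move=> mg g0; apply: measurable_fun_integral_kernel => //; exact/measurable_EFinP.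
Qed.

Let sqreD1 (x : \bar R) : 0 <= x -> (x + 1) ^+ 2 = x ^+ 2 + (x + x + 1).
Proof.
case: x => [r| |]// _.
by rewrite -EFinD -!EFin_expe -!EFinD; congr EFin; ring.
Qed.

(* Compares the second moments of g + 1 and of g. *)
Lemma random_mean_ge0 g : measurable_fun [set: T] g ->
  (forall x, 0 <= g x)%R -> \int[H]_x (g x ^+ 2)%:E < +oo ->
  \int[Pr]_w \int[k w]_x (g x)%:E = (mean g)%:E.
Proof.
move=> mg g0 g2y; set I := fun w => \int[k w]_x (g x)%:E.
have I0 w : 0 <= I w by apply: integral_ge0 => x _; rewrite lee_fin.
have mI : measurable_fun [set: S] I by exact: measurable_random_integral.
have ig := sqr_integrable1 mg g2y.
have ig2 := sqr_integrable mg g2y.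
have mg1 : measurable_fun [set: T] (fun x => g x + 1)%R by exact: measurable_funD.
have g1E x : ((g x + 1) ^+ 2)%:E = (g x ^+ 2)%:E + (2%:E * (g x)%:E + 1).
  by rewrite -EFinM -!EFinD; congr EFin; ring.
have i1 : H.-integrable [set: T] (fun=> 1 : \bar R).
  exact: finite_measure_integrable_cst.
have i2g : H.-integrable [set: T] (fun x => 2%:E * (g x)%:E).
  exact: integrableZl.
have g1y : \int[H]_x ((g x + 1) ^+ 2)%:E =
    (mean (fun x => g x ^+ 2) + (2 * mean g + 1))%:E.
  under eq_integral do rewrite g1E.
  rewrite integralD//; last exact: integrableD.
  rewrite integralD// integral_probability_cst integralZl//.
  rewrite -(fineK (integrable_fin_num measurableT ig)).
  by rewrite -(fineK (integrable_fin_num measurableT ig2)).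
have m1 : mean (fun x => g x + 1)%R = (mean g + 1)%R.
  by rewrite /mean RintegralD// Rintegral_probability_cst.
have g10 x : (0 <= g x + 1)%R by rewrite addr_ge0.
have := moment2 mg1 g10; rewrite m1 g1y ltry => /(_ isT).
have -> : mean (fun x => (g x + 1) ^+ 2)%R =
    (mean (fun x => g x ^+ 2) + (2 * mean g + 1))%R.
  by rewrite /mean /Rintegral g1y.
have -> : \int[Pr]_w (\int[k w]_x (g x + 1)%:E) ^+ 2 =
    \int[Pr]_w (I w ^+ 2 + (I w + I w + 1)).
  apply: eq_integral => w _.
  under eq_integral do rewrite EFinD.
  rewrite ge0_integralD//; last 2 first.
  - by move=> x _; rewrite lee_fin.
  - exact/measurable_EFinP.
  rewrite integral_probability_cst -/(I w).
  exact: sqreD1.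
have mI2 : measurable_fun [set: S] (fun w => I w ^+ 2) by exact: measurable_funXe.
have mII : measurable_fun [set: S] (fun w => I w + I w) by exact: emeasurable_funD.
rewrite ge0_integralD//; last 3 first.
- by move=> w _; rewrite expe_ge0.
- by move=> w _; apply: adde_ge0 => //; exact: adde_ge0.
- exact: emeasurable_funD.
rewrite ge0_integralD//; last by move=> w _; exact: adde_ge0.
rewrite ge0_integralD// moment2// integral_probability_cst.
have : 0 <= \int[Pr]_w I w by exact: integral_ge0.
(* The value +oo contradicts a finite right-hand side. Otherwise, cancelling p H(g^2) + q H(g)^2
   leaves 2r + 1 = (p + q)(2 H(g) + 1). *)
case: (\int[Pr]_w I w) => [r| |]// r0.
rewrite -!EFinD => -[] E; congr EFin.
have : (p = 1 - q)%R by rewrite -pq1 addrK.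
by move=> pE; move: E; rewrite pE; lra.
Qed.

Let pos_sqr f : measurable_fun [set: T] f -> \int[H]_x (f x ^+ 2)%:E < +oo ->
  \int[H]_x ((f^\+)%R x ^+ 2)%:E < +oo.
Proof.
move=> mf; apply: le_lt_trans; apply: ge0_le_integral => //.
- by move=> x _; rewrite lee_fin sqr_ge0.
- by apply/measurable_EFinP; apply: measurable_funX; exact: measurable_funrpos.
- by apply/measurable_EFinP; exact: measurable_funX.
by move=> x _; rewrite lee_fin (sqr_funrposneg f) lerDl sqr_ge0.
Qed.

Let neg_sqr f : measurable_fun [set: T] f -> \int[H]_x (f x ^+ 2)%:E < +oo ->
  \int[H]_x ((f^\-)%R x ^+ 2)%:E < +oo.
Proof.
move=> mf; apply: le_lt_trans; apply: ge0_le_integral => //.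
- by move=> x _; rewrite lee_fin sqr_ge0.
- by apply/measurable_EFinP; apply: measurable_funX; exact: measurable_funrneg.
- by apply/measurable_EFinP; exact: measurable_funX.
by move=> x _; rewrite lee_fin (sqr_funrposneg f) lerDr sqr_ge0.
Qed.

Lemma measurable_random_Rintegral f : measurable_fun [set: T] f ->
  measurable_fun [set: S] (fun w => \int[k w]_x f x)%R.
Proof.
move=> mf; apply: (measurableT_comp (fine_measurable measurableT)).
under eq_fun do rewrite integralE.
apply: emeasurable_funB.
  apply: measurable_fun_integral_kernel => //.
  by apply: measurable_funepos; exact/measurable_EFinP.
apply: measurable_fun_integral_kernel => //.
by apply: measurable_funeneg; exact/measurable_EFinP.
Qed.

Lemma random_mean_ge0_fin g : measurable_fun [set: T] g ->
  (forall x, 0 <= g x)%R -> \int[H]_x (g x ^+ 2)%:E < +oo ->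
  {ae Pr, forall w, \int[k w]_x (g x)%:E \is a fin_num}.
Proof.
move=> mg g0 g2y.
have := @integrable_ae _ _ _ Pr setT measurableT (fun w => \int[k w]_x (g x)%:E).
have -> : Pr.-integrable [set: S] (fun w => \int[k w]_x (g x)%:E).
  apply/integrableP; split; first exact: measurable_random_integral.
  have I0 w : 0 <= \int[k w]_x (g x)%:E.
    by apply: integral_ge0 => x _; rewrite lee_fin.
  under eq_integral do rewrite gee0_abs//.
  by rewrite random_mean_ge0// ltry.
by move=> /(_ isT); apply: filterS => w; apply.
Qed.

(** The integral of |f| under [k w] has the finite mean H(|f|), so it is finite almost surely. *)
Lemma random_integrable_ae f : measurable_fun [set: T] f ->
  \int[H]_x (f x ^+ 2)%:E < +oo ->
  {ae Pr, forall w, (k w).-integrable [set: T] (EFin \o f)}.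
Proof.
move=> mf f2y.
have ma : measurable_fun [set: T] (fun x => `|f x|)%R by exact: measurableT_comp.
have := random_mean_ge0_fin ma (fun x => normr_ge0 (f x)).
under eq_integral do rewrite -normrX ger0_norm ?sqr_ge0//.
move=> /(_ f2y); apply: filterS => w fw; apply/integrableP; split.
  exact/measurable_EFinP.
by rewrite -ge0_fin_numE// integral_ge0.
Qed.

Lemma random_mean f : measurable_fun [set: T] f ->
  \int[H]_x (f x ^+ 2)%:E < +oo ->
  \int[Pr]_w (\int[k w]_x f x)%:E = (mean f)%:E.
Proof.
move=> mf f2y; have [ip inn mE] := Rintegral_funrposneg mf (sqr_integrable1 mf f2y).
have rmean g : measurable_fun [set: T] g -> (forall x, 0 <= g x)%R ->
    \int[H]_x (g x ^+ 2)%:E < +oo ->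
    Pr.-integrable [set: S] (fun w => (\int[k w]_x g x)%:E) /\
    \int[Pr]_w (\int[k w]_x g x)%:E = (mean g)%:E.
  move=> mg g0 g2y.
  have E : \int[Pr]_w (\int[k w]_x g x)%:E = (mean g)%:E.
    rewrite -random_mean_ge0//; apply: ge0_ae_eq_integral => //.
    - by apply/measurable_EFinP; exact: measurable_random_Rintegral.
    - exact: measurable_random_integral.
    - by move=> w _; rewrite lee_fin Rintegral_ge0.
    - by move=> w _; apply: integral_ge0 => x _; rewrite lee_fin.
    by apply: filterS (random_mean_ge0_fin mg g0 g2y) => w fw _; rewrite fineK.
  split=> //; apply/integrableP; split.
    by apply/measurable_EFinP; exact: measurable_random_Rintegral.
  have I0 w : 0 <= (\int[k w]_x g x)%:E by rewrite lee_fin Rintegral_ge0.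
  under eq_integral do rewrite gee0_abs//.
  by rewrite E ltry.
have [ipw pE] := rmean _ (measurable_funrpos mf) (funrpos_ge0 f) (pos_sqr mf f2y).
have [inw nE] := rmean _ (measurable_funrneg mf) (funrneg_ge0 f) (neg_sqr mf f2y).
rewrite /mean mE EFinB -/(mean _) -/(mean (f^\-)%R) -pE -nE -integralB_EFin//.
apply: ae_eq_integral => //.
- by apply/measurable_EFinP; exact: measurable_random_Rintegral.
- by apply: emeasurable_funB; apply/measurable_EFinP;
    apply: measurable_random_Rintegral;
    [exact: measurable_funrpos|exact: measurable_funrneg].
apply: filterS (random_integrable_ae mf f2y) => w iw _.
by have [_ _ ->] := Rintegral_funrposneg mf iw; rewrite EFinB.
Qed.

Lemma random_moment2 f : measurable_fun [set: T] f ->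
  \int[H]_x (f x ^+ 2)%:E < +oo ->
  \int[Pr]_w ((\int[k w]_x f x) ^+ 2)%:E =
  (p * mean (fun x => f x ^+ 2) + q * mean f ^+ 2)%:E.
Proof.
move=> mf f2y; have [ip inn mE] := Rintegral_funrposneg mf (sqr_integrable1 mf f2y).
have p2y := pos_sqr mf f2y; have n2y := neg_sqr mf f2y.
have ma : measurable_fun [set: T] (fun x => `|f x|)%R by exact: measurableT_comp.
have a2E : (fun x => `|f x| ^+ 2)%R = (fun x => f x ^+ 2)%R.
  by apply/funext => x; rewrite real_normK// num_real.
have a2y : \int[H]_x (`|f x| ^+ 2)%:E < +oo.
  by under eq_integral do rewrite real_normK ?num_real//.
have absE x : (`|f x| = (f^\+)%R x + (f^\-)%R x)%R.
  by have /(congr1 (@^~ x)) := funrposDneg f.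
have maE : mean (fun x => `|f x|)%R = (mean (f^\+)%R + mean (f^\-)%R)%R.
  by rewrite /mean -RintegralD//; apply: eq_Rintegral => x _; exact: absE.
have m2E : mean (fun x => f x ^+ 2)%R =
    (mean (fun x => (f^\+)%R x ^+ 2) + mean (fun x => (f^\-)%R x ^+ 2))%R.
  rewrite /mean -RintegralD//.
  - by apply: eq_Rintegral => x _; exact: sqr_funrposneg.
  - by apply: sqr_integrable => //; exact: measurable_funrpos.
  - by apply: sqr_integrable => //; exact: measurable_funrneg.
have := moment2 (measurable_funrpos mf) (funrpos_ge0 f) p2y.
have := moment2 (measurable_funrneg mf) (funrneg_ge0 f) n2y.
have := moment2 ma (fun x => normr_ge0 (f x)) a2y.
rewrite a2E; set Ja := fun w => \int[k w]_x (`|f x|)%:E.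
set Jn := fun w => \int[k w]_x ((f^\-)%R x)%:E.
set Jp := fun w => \int[k w]_x ((f^\+)%R x)%:E => Ea En Ep.
have Ja0 w : 0 <= Ja w by apply: integral_ge0.
have Jp0 w : 0 <= Jp w by apply: integral_ge0 => x _; rewrite lee_fin.
have Jn0 w : 0 <= Jn w by apply: integral_ge0 => x _; rewrite lee_fin.
have mJa : measurable_fun [set: S] (fun w => Ja w ^+ 2).
  by apply: measurable_funXe; exact: measurable_random_integral.
have mJp : measurable_fun [set: S] (fun w => 2%:E * Jp w ^+ 2).
  apply: measurable_funeM; apply: measurable_funXe.
  by apply: measurable_random_integral => //; exact: measurable_funrpos.
have mJn : measurable_fun [set: S] (fun w => 2%:E * Jn w ^+ 2).
  apply: measurable_funeM; apply: measurable_funXe.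
  by apply: measurable_random_integral => //; exact: measurable_funrneg.
have mX : measurable_fun [set: S] (fun w => ((\int[k w]_x f x) ^+ 2)%:E).
  apply/measurable_EFinP; apply: measurable_funX.
  exact: measurable_random_Rintegral.
have : \int[Pr]_w (((\int[k w]_x f x) ^+ 2)%:E + Ja w ^+ 2) =
    \int[Pr]_w (2%:E * Jp w ^+ 2 + 2%:E * Jn w ^+ 2).
  apply: ge0_ae_eq_integral => //.
  - exact: emeasurable_funD.
  - exact: emeasurable_funD.
  - by move=> w _; rewrite adde_ge0 ?expe_ge0// lee_fin sqr_ge0.
  - by move=> w _; rewrite adde_ge0 ?mule_ge0 ?expe_ge0.
  apply: filterS (random_integrable_ae mf f2y) => w iw _.
  have [ipw inw ->] := Rintegral_funrposneg mf iw.
  have -> : Ja w = Jp w + Jn w.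
    rewrite /Ja /Jp /Jn -ge0_integralD//.
    - by apply: eq_integral => x _; rewrite absE EFinD.
    - by move=> x _; rewrite lee_fin.
    - by apply/measurable_EFinP; exact: measurable_funrpos.
    - by move=> x _; rewrite lee_fin.
    - by apply/measurable_EFinP; exact: measurable_funrneg.
  have -> : Jp w = (\int[k w]_x (f^\+)%R x)%:E.
    by rewrite fineK// integrable_fin_num.
  have -> : Jn w = (\int[k w]_x (f^\-)%R x)%:E.
    by rewrite fineK// integrable_fin_num.
  by rewrite -EFinD -!EFin_expe -!EFinM -!EFinD; congr EFin; ring.
rewrite ge0_integralD//; last 2 first.
- by move=> w _; rewrite lee_fin sqr_ge0.
- by move=> w _; rewrite expe_ge0.
rewrite ge0_integralD//; last 2 first.
- by move=> w _; rewrite mule_ge0 ?expe_ge0.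
- by move=> w _; rewrite mule_ge0 ?expe_ge0.
rewrite !ge0_integralZl_EFin//; last 4 first.
- by move=> w _; rewrite expe_ge0.
- by apply: measurable_funXe; apply: measurable_random_integral => //;
    exact: measurable_funrneg.
- by move=> w _; rewrite expe_ge0.
- by apply: measurable_funXe; apply: measurable_random_integral => //;
    exact: measurable_funrpos.
rewrite Ea En Ep -!EFinM -EFinD.
case: (\int[Pr]_w _) => [r| |]//; rewrite -EFinD => -[] E; congr EFin.
have -> : mean f = (mean (f^\+)%R - mean (f^\-)%R)%R by exact: mE.
by move: E; rewrite maE m2E; lra.
Qed.

Lemma random_integral_shift f (r : R) : measurable_fun [set: T] f ->
  \int[H]_x (f x ^+ 2)%:E < +oo ->
  {ae Pr, forall w, (\int[k w]_x (f x - r) = \int[k w]_x f x - r)%R}.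
Proof.
move=> mf f2y; apply: filterS (random_integrable_ae mf f2y) => w iw.
rewrite RintegralB//; last exact: finite_measure_integrable_cst.
by rewrite Rintegral_probability_cst.
Qed.

(** Apply the second-moment formula to f - H(f): its mean under H is 0, so the q term disappears. *)
Lemma random_variance f : measurable_fun [set: T] f ->
  \int[H]_x (f x ^+ 2)%:E < +oo ->
  'V_Pr[fun w => (\int[k w]_x f x)%R] =
  (p * (mean (fun x => f x ^+ 2) - mean f ^+ 2))%:E.
Proof.
move=> mf f2y; set m := mean f.
have fi := sqr_integrable1 mf f2y; have f2i := sqr_integrable mf f2y.
have gE x : ((f x - m) ^+ 2)%:E =
    (f x ^+ 2)%:E + ((- (2 * m))%:E * (f x)%:E + (m ^+ 2)%:E).
  by rewrite -EFinM -!EFinD; congr EFin; ring.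
have ic (r : R) : H.-integrable [set: T] (fun=> r%:E).
  exact: finite_measure_integrable_cst.
have g2 : \int[H]_x ((f x - m) ^+ 2)%:E =
    (mean (fun x => f x ^+ 2) - m ^+ 2)%:E.
  under eq_integral do rewrite gE.
  have i1 : H.-integrable [set: T] (fun x => (- (2 * m))%:E * (f x)%:E).
    exact: integrableZl.
  rewrite integralD//; last exact: integrableD.
  rewrite integralD// integral_probability_cst integralZl//.
  have -> : \int[H]_x (f x)%:E = m%:E.
    by rewrite fineK// integrable_fin_num.
  have -> : \int[H]_x (f x ^+ 2)%:E = (mean (fun x => f x ^+ 2)%R)%:E.
    by rewrite fineK// integrable_fin_num.
  by rewrite -EFinM -!EFinD; congr EFin; ring.
have mg : measurable_fun [set: T] (fun x => f x - m)%R by exact: measurable_funB.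
have g2y : \int[H]_x ((f x - m) ^+ 2)%:E < +oo by rewrite g2 ltry.
have mg0 : mean (fun x => f x - m)%R = 0%R.
  rewrite /mean RintegralB//; last exact: ic.
  by rewrite Rintegral_probability_cst subrr.
have := random_moment2 mg g2y.
rewrite mg0 expr0n/= mulr0 addr0.
have -> : mean (fun x => (f x - m) ^+ 2)%R = (mean (fun x => f x ^+ 2) - m ^+ 2)%R.
  by rewrite /mean /Rintegral g2.
move=> <-; rewrite /variance unlock [in X in 'E_Pr[X]]unlock random_mean// unlock/=.
apply: ge0_ae_eq_integral => //.
- apply/measurable_EFinP; apply: measurable_funM;
    by apply: measurable_funB => //; exact: measurable_random_Rintegral.
- apply/measurable_EFinP; apply: measurable_funX.
  exact: measurable_random_Rintegral.
- by move=> w _; rewrite lee_fin -expr2 sqr_ge0.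
- by move=> w _; rewrite lee_fin sqr_ge0.
apply: filterS (random_integral_shift m mf f2y) => w -> _.
by rewrite expr2.
Qed.

End random_probability.

(** * Laws of normalized random measures and spike and slab mixtures *)

(** Evaluations generate the sigma-algebra of [pprobability], so kernel measurability of each
    evaluation is enough. *)
Lemma measurable_fun_mnormalizeP d (S : measurableType d) d' (T : measurableType d')
    (R : realType) (mu : R.-ker S ~> T) (H : probability T R) :
  measurable_fun [set: S] (fun w => mnormalize (mu w) H : pprobability T R).
Proof.
apply: (measurability (@pset _ _ _ : set (set (pprobability T R)))) => //.
move=> _ -[_ [r r01] [U mU <-]] <-.
apply: emeasurable_fun_infty_o => //.
exact: (measurable_kernel (knormalize mu H) _ mU).
Qed.

Lemma measurable_pprobability_eval d (T : measurableType d) (R : realType) U :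
  measurable U -> measurable_fun [set: pprobability T R] (fun m => m U).
Proof.
move=> mU; exact: (measurable_kernel (kprobability (@measurable_id _ _ setT)) _ mU).
Qed.

Section hNRMI_moments.
Context {R : realType} d {T : measurableType d}.
Variables (rho : R -> R) (hrho : levy_density rho) (c : R) (c_gt0 : (0 < c)%R).
Variables (H : probability T R) (L : probability (pprobability T R) R).
Hypothesis hL : hNRMI rho c H L.

(** [L] is the pushforward of [Pr] by normalization, so the moment formula moves to it by change of
    variables. *)
Lemma hNRMI_moment2 (f : T -> R) : measurable_fun [set: T] f ->
  (forall x, 0 <= f x)%R -> \int[H]_x (f x ^+ 2)%:E < +oo ->
  \int[L]_m (\int[m]_x (f x)%:E) ^+ 2 =
  pcoef rho c * \int[H]_x (f x ^+ 2)%:E +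
  qcoef rho c * (fine (\int[H]_x (f x)%:E) ^+ 2)%:E.
Proof.
move=> mf f0 f2y; have [d' [S [Pr [mu [[_ hmu mu_fin] LE]]]]] := hL.
rewrite -(crm_normalized_moment2 hrho c_gt0 hmu mu_fin mf f0 f2y).
pose phi w : pprobability T R := mnormalize (mu w) H.
have mphi : measurable_fun [set: S] phi by exact: measurable_fun_mnormalizeP.
have mI : measurable_fun [set: pprobability T R]
    (fun m => (\int[m]_x (f x)%:E) ^+ 2).
  apply: measurable_funXe; apply: measurable_fun_integral_kernel.
  - exact: measurable_pprobability_eval.
  - by move=> x; rewrite lee_fin.
  - exact/measurable_EFinP.
transitivity (\int[pushforward Pr phi]_m (\int[m]_x (f x)%:E) ^+ 2).
  by apply: eq_measure_integral => A mA _; exact: LE.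
rewrite ge0_integral_pushforward// => m _.
by rewrite expe_ge0// integral_ge0// => x _; rewrite lee_fin.
Qed.

Lemma pcoefDqcoef : pcoef rho c + qcoef rho c = 1.
Proof.
have one2 : (fun=> (1 ^+ 2)%:E) = (fun=> 1 : \bar R) :> (T -> _).
  by apply/funext => x; rewrite expr1n.
have := @hNRMI_moment2 (fun=> 1%R) (measurable_cst _) (fun=> ler01).
rewrite one2 !integral_probability_cst ltry /= expr1n !mule1 => <-//.
rewrite -[RHS](integral_probability_cst L); apply: eq_integral => m _.
by rewrite integral_probability_cst mule1.
Qed.

(** Two positive extended reals with sum 1 are finite, and each is below 1. *)
Lemma hNRMI_coef_fin :
  [/\ pcoef rho c \is a fin_num, qcoef rho c \is a fin_num,
      (0 < fine (pcoef rho c) < 1)%R &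
      (fine (pcoef rho c) + fine (qcoef rho c) = 1)%R].
Proof.
have := pcoefDqcoef.
have := pcoef_gt0 hrho c_gt0; have := qcoef_gt0 hrho c_gt0.
case: (pcoef rho c) => [p| |]//; case: (qcoef rho c) => [q| |]//.
rewrite !lte_fin -EFinD /= => q0 p0 [] pq; split => //.
by rewrite p0/= -pq ltrDl.
Qed.

End hNRMI_moments.

Lemma hNRMI_random_moment2 (R : realType) d (T : measurableType d)
    (rho : R -> R) (hrho : levy_density rho) (c : R) (c_gt0 : (0 < c)%R)
    (H : probability T R) d' (S : measurableType d') (Pr : probability S R)
    (P : {RV Pr >-> pprobability T R}) (hP : hNRMI rho c H (distribution Pr P))
    (f : T -> R) : measurable_fun [set: T] f ->
  (forall x, 0 <= f x)%R -> \int[H]_x (f x ^+ 2)%:E < +oo ->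
  \int[Pr]_w (\int[P w]_x (f x)%:E) ^+ 2 =
  (fine (pcoef rho c) * (\int[H]_x (f x ^+ 2)) +
   fine (qcoef rho c) * (\int[H]_x (f x)) ^+ 2)%:E.
Proof.
move=> mf f0 f2y.
have [pfin qfin _ _] := hNRMI_coef_fin hrho c_gt0 hP.
have := hNRMI_moment2 hrho c_gt0 hP mf f0 f2y.
rewrite ge0_integral_distribution; last 2 first.
- apply: measurable_funXe; apply: measurable_fun_integral_kernel.
  + exact: measurable_pprobability_eval.
  + by move=> x; rewrite lee_fin.
  + exact/measurable_EFinP.
- by move=> m; rewrite expe_ge0// integral_ge0// => x _; rewrite lee_fin.
have f2fin : \int[H]_x (f x ^+ 2)%:E \is a fin_num.
  by rewrite ge0_fin_numE// integral_ge0// => x _; rewrite lee_fin sqr_ge0.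
move=> ->; rewrite -{1}(fineK pfin) -{1}(fineK qfin) -{1}(fineK f2fin).
by rewrite -!EFinM -EFinD.
Qed.

Lemma measurable_RV_eval (R : realType) d (T : measurableType d)
    d' (S : measurableType d') (Pr : probability S R)
    (P : {RV Pr >-> pprobability T R}) U : measurable U ->
  measurable_fun [set: S] (fun w => P w U).
Proof.
move=> mU; apply: (measurableT_comp (measurable_pprobability_eval mU)).
exact: measurable_funPT.
Qed.

Lemma hNRMI_variance (R : realType) d (T : measurableType d)
    (rho : R -> R) (hrho : levy_density rho) (c : R) (c_gt0 : (0 < c)%R)
    (H : probability T R) d' (S : measurableType d') (Pr : probability S R)
    (P : {RV Pr >-> pprobability T R}) (hP : hNRMI rho c H (distribution Pr P))
    (f : T -> R) : measurable_fun [set: T] f ->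
  \int[H]_x (f x ^+ 2)%:E < +oo ->
  'V_Pr[fun w => (\int[P w]_x f x)%R] =
  (fine (pcoef rho c) * (\int[H]_x (f x ^+ 2) - (\int[H]_x f x) ^+ 2))%:E.
Proof.
have [_ _ _ pq1] := hNRMI_coef_fin hrho c_gt0 hP.
move=> mf f2y; apply: (@random_variance _ _ _ _ _ Pr P H _ _ _ pq1) => //.
- exact: measurable_RV_eval.
- exact: hNRMI_random_moment2.
Qed.

(** * Integrals and variances under a spike and slab mixture *)

Section spike_slab_integral.
Context {R : realType} d {T : measurableType d}.
Variables (z : {i01 R}) (x0 : T) (P : probability T R).

Lemma ge0_integral_spike_slab (g : T -> R) : measurable_fun [set: T] g ->
  (forall x, 0 <= g x)%R ->
  \int[spike_slab z x0 P]_x (g x)%:E =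
  (z%:num * g x0)%:E + (1 - z%:num)%:E * \int[P]_x (g x)%:E.
Proof.
move=> mg g0; have mg' : measurable_fun [set: T] (EFin \o g).
  exact/measurable_EFinP.
rewrite ge0_integral_measure_add//; last by move=> x _; rewrite lee_fin.
rewrite ge0_integral_mscale//; last by move=> x _; rewrite lee_fin.
rewrite ge0_integral_mscale//; last by move=> x _; rewrite lee_fin.
by rewrite integral_dirac// diracT mul1e EFinM.
Qed.

Lemma Rintegral_spike_slab (f : T -> R) : measurable_fun [set: T] f ->
  P.-integrable [set: T] (EFin \o f) ->
  (\int[spike_slab z x0 P]_x f x = z%:num * f x0 + (1 - z%:num) * \int[P]_x f x)%R.
Proof.
move=> mf fi; have [ip iN ->] := Rintegral_funrposneg mf fi.
have ma : measurable_fun [set: T] (fun x => `|f x|)%R by exact: measurableT_comp.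
have fi' : (spike_slab z x0 P).-integrable [set: T] (EFin \o f).
  apply/integrableP; split; first exact/measurable_EFinP.
  rewrite ge0_integral_spike_slab//.
  move/integrableP : fi => [_ fy].
  by rewrite lte_add_pinfty ?ltry// lte_mul_pinfty// lee_fin subr_ge0.
have [_ _ ->] := Rintegral_funrposneg mf fi'.
rewrite {1 2}/Rintegral !ge0_integral_spike_slab//; last 2 first.
- exact: measurable_funrneg.
- exact: measurable_funrpos.
have -> : \int[P]_x ((f^\+)%R x)%:E = (\int[P]_x (f^\+)%R x)%:E.
  by rewrite fineK// integrable_fin_num.
have -> : \int[P]_x ((f^\-)%R x)%:E = (\int[P]_x (f^\-)%R x)%:E.
  by rewrite fineK// integrable_fin_num.
have fE : (f x0 = (f^\+)%R x0 - (f^\-)%R x0)%R.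
  by have /(congr1 (@^~ x0)) := esym (funrposBneg f).
by rewrite -!EFinM -!EFinD /= fE; ring.
Qed.

End spike_slab_integral.

(** The relation is only almost sure because, in the outer model, splitting the integral of f
    requires f to be integrable under the realization of [Qstar]. *)
Lemma ae_affine_variance (R : realType) d (S : measurableType d)
    (Pr : probability S R) (X Y : S -> R) (a b : R) :
  measurable_fun [set: S] Y -> Pr.-integrable [set: S] (EFin \o X) ->
  {ae Pr, forall w, Y w = a + b * X w}%R ->
  'V_Pr[Y] = (b ^+ 2)%:E * 'V_Pr[X].
Proof.
move=> mY iX YX; have mX : measurable_fun [set: S] X.
  by apply/measurable_EFinP; exact: measurable_int iX.
have EY : 'E_Pr[Y] = (a + b * fine 'E_Pr[X])%:E.
  rewrite unlock; transitivity (\int[Pr]_w (a%:E + b%:E * (X w)%:E)).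
    apply: ae_eq_integral => //.
    - exact/measurable_EFinP.
    - apply: emeasurable_funD => //; apply: measurable_funeM.
      exact/measurable_EFinP.
    by apply: filterS YX => w -> _; rewrite EFinD EFinM.
  rewrite integralD//; last 2 first.
  - exact: finite_measure_integrable_cst.
  - exact: integrableZl.
  rewrite integral_probability_cst integralZl// EFinD EFinM fineK//.
  exact: integrable_fin_num.
rewrite /variance [in LHS]unlock [in RHS]unlock EY /=.
set m := fine 'E_Pr[X]; rewrite [in LHS]unlock [in RHS]unlock.
rewrite -ge0_integralZl_EFin//; last 3 first.
- by move=> w _; rewrite lee_fin -expr2 sqr_ge0.
- apply/measurable_EFinP.
  by apply: measurable_funM; apply: measurable_funB.
- exact: sqr_ge0.
apply: ge0_ae_eq_integral => //.
- by apply/measurable_EFinP; apply: measurable_funM; apply: measurable_funB.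
- apply: measurable_funeM; apply/measurable_EFinP.
  by apply: measurable_funM; apply: measurable_funB.
- by move=> w _; rewrite lee_fin -expr2 sqr_ge0.
- by move=> w _; rewrite -EFinM lee_fin mulr_ge0 ?sqr_ge0// -expr2 sqr_ge0.
apply: filterS YX => w YE _; rewrite -EFinM; congr EFin.
transitivity ((Y w - (a + b * m)) * (Y w - (a + b * m)))%R; first by [].
transitivity (b ^+ 2 * ((X w - m) * (X w - m)))%R; last by [].
by rewrite YE; ring.
Qed.

Theorem proposition1 (R : realType) (X : ptopologicalType) (hX : polish R X)
    (rho : R -> R) (hrho : levy_density rho)
    (zeta : {i01 R}) (zeta_gt0 : (0 < zeta%:num)%R) (zeta_lt1 : (zeta%:num < 1)%R)
    (c : R) (c_gt0 : (0 < c)%R) (x0 : borel X)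
    (Pstar : probability (borel X) R) (hPstar : diffuse Pstar)
    (d1 : measure_display) (S1 : measurableType d1) (Pr1 : probability S1 R)
    (Pt : {RV Pr1 >-> pprobability (borel X) R})
    (hPt : hNRMI rho c (spike_slab zeta x0 Pstar) (distribution Pr1 Pt))
    (d2 : measure_display) (S2 : measurableType d2) (Pr2 : probability S2 R)
    (Qstar : {RV Pr2 >-> pprobability (borel X) R})
    (hQstar : hNRMI rho c Pstar (distribution Pr2 Qstar))
    (f : borel X -> R) (mf : measurable_fun [set: borel X] f)
    (hf : \int[Pstar]_x (f x ^+ 2)%:E < +oo) :
  let Qt := fun w : S2 => spike_slab zeta x0 (Qstar w) in
  let varP := 'V_Pr1[fun w => (\int[Pt w]_x f x)%R] in
  let varQ := 'V_Pr2[fun w => (\int[Qt w]_x f x)%R] in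
  let p := pcoef rho c in
  let rhs := p * (zeta%:num * (1 - zeta%:num))%:E *
             \int[Pstar]_x ((f x - f x0) ^+ 2)%:E in
  [/\ varP - varQ = rhs, 0 <= rhs, 0 < p & p < 1].
Proof.
move=> Qt varP varQ p rhs; set z : R := zeta%:num in rhs *.
have f2i := sqr_integrable mf hf; have fi := sqr_integrable1 mf hf.
have mf2 : measurable_fun [set: borel X] (fun x => f x ^+ 2)%R.
  exact: measurable_funX.
pose m1 := (\int[Pstar]_x f x)%R; pose m2 := (\int[Pstar]_x (f x ^+ 2))%R.
have E1 : \int[Pstar]_x (f x)%:E = m1%:E by rewrite fineK// integrable_fin_num.
have E2 : \int[Pstar]_x (f x ^+ 2)%:E = m2%:E by rewrite fineK// integrable_fin_num.
have [pfin _ /andP[p0 p1] pq1] := hNRMI_coef_fin hrho c_gt0 hPt.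
have [_ _ _ pq1'] := hNRMI_coef_fin hrho c_gt0 hQstar.
have pE : p = (fine p)%:E by rewrite fineK.
(* The atom only adds the finite term z f(x0)^2. *)
have f2y0 : \int[spike_slab zeta x0 Pstar]_x (f x ^+ 2)%:E < +oo.
  rewrite ge0_integral_spike_slab//; last by move=> x; exact: sqr_ge0.
  by rewrite E2 -EFinM -EFinD ltry.
have VP : varP = (fine p * (z * f x0 ^+ 2 + (1 - z) * m2 -
    (z * f x0 + (1 - z) * m1) ^+ 2))%:E.
  rewrite /varP (hNRMI_variance hrho c_gt0 hPt mf f2y0).
  by rewrite !Rintegral_spike_slab.
have mQ U : measurable U -> measurable_fun [set: S2] (fun w => Qstar w U).
  exact: measurable_RV_eval.
have momQ := @hNRMI_random_moment2 _ _ _ _ hrho _ c_gt0 _ _ _ _ _ hQstar.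
have mX := measurable_random_Rintegral mQ mf.
have iX : Pr2.-integrable [set: S2] (EFin \o (fun w => (\int[Qstar w]_x f x)%R)).
  apply: sqr_integrable1 => //.
  by rewrite (random_moment2 mQ pq1' momQ mf hf) ltry.
have mQt U : measurable U -> measurable_fun [set: S2] (fun w => Qt w U).
  move=> mU; rewrite (_ : (fun _ => _) = (fun w =>
      z%:E * \d_x0 U + (1 - z)%:E * Qstar w U)); last first.
    by apply/funext => w; rewrite /Qt /= /spike_slab measure_addE.
  apply: emeasurable_funD; first exact: measurable_cst.
  by apply: measurable_funeM; exact: mQ.
(* The spike is deterministic here, so only the slab varies. The coefficient p is the one of the
   inner model because it depends on rho and c alone. *)
have VQ : varQ = ((1 - z) ^+ 2 * (fine p * (m2 - m1 ^+ 2)))%:E.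
  rewrite /varQ (@ae_affine_variance _ _ _ _ _ _ (z * f x0) (1 - z) _ iX).
  - by rewrite (hNRMI_variance hrho c_gt0 hQstar mf hf) -EFinM.
  - exact: (measurable_random_Rintegral mQt mf).
  apply: filterS (random_integrable_ae mQ pq1' momQ mf hf) => w iw.
  exact: Rintegral_spike_slab.
have ic (r : R) : Pstar.-integrable [set: borel X] (fun=> r%:E).
  exact: finite_measure_integrable_cst.
have ED : \int[Pstar]_x ((f x - f x0) ^+ 2)%:E =
    (m2 - 2 * f x0 * m1 + f x0 ^+ 2)%:E.
  have i1 : Pstar.-integrable [set: borel X] (fun x => (- (2 * f x0))%:E * (f x)%:E).
    exact: integrableZl.
  transitivity (\int[Pstar]_x ((f x ^+ 2)%:E +
      ((- (2 * f x0))%:E * (f x)%:E + (f x0 ^+ 2)%:E))).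
    by apply: eq_integral => x _; rewrite -EFinM -!EFinD; congr EFin; ring.
  rewrite integralD//; last exact: integrableD.
  rewrite integralD// integral_probability_cst integralZl// E1 E2.
  by rewrite -EFinM -!EFinD; congr EFin; ring.
have rhsE : rhs = (fine p * (z * (1 - z)) * (m2 - 2 * f x0 * m1 + f x0 ^+ 2))%:E.
  by rewrite /rhs ED pE -!EFinM.
split.
(* The m1^2 terms cancel, and m2 keeps the coefficient (1 - z) - (1 - z)^2 = z (1 - z). *)
- by rewrite VP VQ rhsE -EFinB; congr EFin; ring.
- rewrite rhsE lee_fin; apply: mulr_ge0.
    by rewrite mulr_ge0 ?mulr_ge0 ?subr_ge0// ltW.
  by rewrite -lee_fin -ED integral_ge0// => x _; rewrite lee_fin sqr_ge0.
- by rewrite pE lte_fin.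
- by rewrite pE lte_fin.
Qed.
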